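(* Let $\alpha\in\mathbb{Q}\cap(0,1/2)$ with $1/\alpha\notin\mathbb{Z}$. Let $\mathfrak{z}_1$ be the geometric root of $\mathcal{Q}(\alpha)$, and let $\mathfrak{z}_n=\mathcal{Z}(e_n)_{\mathfrak{z}_1}$ be the shape parameter of the last tetrahedral pair in the geometric Sakuma--Weeks triangulation of $M_\alpha$ given by $\alpha$ and $\mathfrak{z}_1$. If the isometry $\phi_\alpha:M_\alpha\to M_{\bar\alpha}$ is orientation reversing, then $\overline{\mathfrak{z}_n}^{\,-1}$ is the geometric root of $\mathcal{Q}(\bar\alpha)$. Moreover, $\phi_\alpha$ is orientation reversing if and only if $|\mathfrak{z}_n|\ge1$.
   Context: Farey notation. $\mathbb{Q}_0=\mathbb{Q}\cap[0,1]$, $\widehat{\mathbb{Q}}_0=\mathbb{Q}_0\cup\{\infty\}$; fractions are in lowest terms with positive denominator, $0=0/1$, $1=1/1$, $\infty=1/0$. A pair $\{p/q,r/s\}\subset\widehat{\mathbb{Q}}_0$ is a Farey pair if $ps-rq=\pm1$; $p/q\oplus r/s=(p+r)/(q+s)$; $\gamma\oplus^0\beta=\gamma$, $\gamma\oplus^j\beta=(\gamma\oplus^{j-1}\beta)\oplus\beta$. Edges. An edge is a Farey pair $e\subset\mathbb{Q}_0$, with endpoints $e^L<e^R$. For $e\neq\{0,1\}$, $e^-$ and $e^+$ are the endpoints with smaller and larger denominator, $\hat e\in\mathbb{Q}_0$ is determined by $\hat e\oplus e^-=e^+$, and $\nu(e)=-1$ if $e^-=e^L$, $\nu(e)=1$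 if $e^-=e^R$. Polynomials. $d_{\mathcal Q}(p/q)=(-1)^px^q$. $\mathcal{Q}:\widehat{\mathbb{Q}}_0\to\mathbb{Z}[x]$ is the unique function with $\mathcal{Q}(0)=1,\mathcal{Q}(\infty)=0,\mathcal{Q}(1)=1$ and $\mathcal{Q}(\gamma\oplus^2\beta)=-d_{\mathcal Q}(\beta)\mathcal{Q}(\gamma)+\mathcal{Q}(\beta)\mathcal{Q}(\gamma\oplus\beta)$ for every Farey pair $\{\beta,\gamma\}$ with $\gamma\oplus^2\beta\in\mathbb{Q}_0$. Put $\mathcal{Z}(e)=-d_{\mathcal Q}(\hat e)^{-\nu(e)}(\mathcal{Q}(e^L)/\mathcal{Q}(e^R))^2$. A subscript $\mathfrak z$ denotes evaluation at $x=\mathfrak{z}$. Funnel. $F_\alpha$ has edges $e_0,\dots,e_{n+1}$: $e_0=\{0,1\}$; given $e_j$, let $c=e_j^L\oplus e_j^R$; if $c=\alpha$ stop and set $j=n+1$; if $\alpha<c$ then $e_{j+1}=\{e_j^L,c\}$; if $\alpha>c$ then $e_{j+1}=\{c,e_j^R\}$. Interior edges: $e_1,\dots,e_n$, $n\ge1$. Let $s_j=\{e_j^L,e_j^R,e_j^L\oplus e_j^R\}$, $0\le j\le n$. Geometric root. For $1/\alpha\notin\mathbb{Z}$ it is the unique $\mathfrak{z}\in\mathbb{C}$ with $\operatorname{Im}\mathfrak z>0$, $\mathcal{Q}(\alpha)_{\mathfrak z}=0$ and $\operatorname{Im}\mathcal{Z}(e_j)_{\mathfrak z}>0$ for $1\le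 j\le n$. Sakuma--Weeks triangulation. Let $X=\mathbb{C}-\mathbb{Z}[i]$ and $\Theta$ the group generated by the order-2 rotations about points of $\mathbb{Z}[i]$. For $0\le j\le n$ let $X_j$ be a copy of $X$ ideally triangulated by all lines through points of $\mathbb{Z}[i]$ with slope in $s_j$; edges are labeled by slope. For $1\le j\le n$, $X_{j-1}$ and $X_j$ share the edges with slopes $e_j^\pm$; each parallelogram cut out by these has a diagonal of slope $\hat e_j$ in $X_{j-1}$ and one of slope $e_j^L\oplus e_j^R$ in $X_j$, and is filled by an ideal tetrahedron having the two diagonals as opposite edges. Stacking from top to bottom and taking the quotient by $\Theta$ gives a complex $K$ with two tetrahedra $\Delta_j$ for each $1\le j\le n$. $M_\alpha$, the complement in $S^3$ of the 2-bridge link $L_\alpha$, is obtained from $K$ by folding $X_0/\Theta$ across its edges labeled $1/2$ and $X_n/\Theta$ across its edges labeled $\hat e_{n+1}$. $M_\alpha$ carries the complete hyperbolic structure (and the orientation) in which the tetrahedra of $\Delta_j$ are positively oriented ideal tetrahedra with parameter $t=\mathcal{Z}(e_j)_{\mathfrak{z}_1}$ at the edges labeled $\hat e_j$ and $e_j^L\oplus e_j^R$, $\zeta(t)=1/(1-t)$ at those labeled $e_j^L$ and $\zeta(\zeta(t))$ at those labeled $e_j^R$. Reverse. Let $\alpha=p/q=[0;a_1,\dots,a_k]$ be the continued fraction with positive terms and $a_1,a_k\ge2$. The reverse is $\bar\alpha=[0;a_k,\dots,a_1]$. Let $r/s=e_{n+1}^-$ and $\phi_\alpha(t)=(-st+r)/(-qt+p)$.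 This M\''obius function maps the vertices of $F_\alpha$ to those of $F_{\bar\alpha}$, taking the $j$th edge of $F_\alpha$ to the $(n+1-j)$th edge of $F_{\bar\alpha}$ for $0\le j\le n+1$. It induces a simplicial homeomorphism $\phi_\alpha:M_\alpha\to M_{\bar\alpha}$ of Sakuma--Weeks triangulations, taking $\Delta_j$ to $\Delta_{n+1-j}$ and edges labeled $\gamma$ to edges labeled $\phi_\alpha(\gamma)$, which is an isometry for the complete hyperbolic structures. *)

(* Defs.v *)
From Stdlib Require Import Relation_Operators.
From HB Require Import structures.
From mathcomp Require Import all_boot all_order all_algebra.
From mathcomp Require Import archimedean reals complex.

Set Implicit Arguments.
Unset Strict Implicit.
Unset Printing Implicit Defensive.

Import Order.TTheory GRing.Theory Num.Theory.
Local Open Scope ring_scope.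

(** * Farey fractions and edges *)

(* The fraction p/q in lowest terms with q >= 0 is the vector (p, q), so that
   infinity = 1/0 is (1, 0).  The operation (+) on fractions is then the
   addition + of vectors, and gamma (+)^j beta is gamma + beta *+ j. *)
Definition slope := (int * int)%type.

Definition f0 : slope := (0, 1).
Definition f1 : slope := (1, 1).
Definition finfty : slope := (1, 0).
Definition fhalf : slope := (1, 2).

Definition frac_of (x : rat) : slope := (numq x, denq x).
Definition rat_of (f : slope) : rat := f.1%:Q / f.2%:Q.

Definition inQ0 (f : slope) : bool :=
  [&& 0 < f.2, 0 <= f.1, f.1 <= f.2 & coprimez f.1 f.2].

Definition inQ0hat (f : slope) : bool := inQ0 f || (f == finfty).

Definition farey_pair (f g : slope) : bool :=
  [&& inQ0hat f, inQ0hat g & `|f.1 * g.2 - g.1 * f.2| == 1].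

(* An edge e is the pair (e^L, e^R). *)
Definition edge := (slope * slope)%type.

Definition apex (e : edge) : slope := e.1 + e.2.

Definition eminus (e : edge) : slope := if e.1.2 < e.2.2 then e.1 else e.2.
Definition eplus (e : edge) : slope := if e.1.2 < e.2.2 then e.2 else e.1.
Definition ehat (e : edge) : slope := eplus e - eminus e.
Definition nu (e : edge) : int := if eminus e == e.1 then -1 else 1.

(** * The funnel of alpha *)

Definition funnel_step (alpha : rat) (e : edge) : edge :=
  if alpha < rat_of (apex e) then (e.1, apex e) else (apex e, e.2).

(* This is e_j for 0 <= j <= n + 1; later values are irrelevant. *)
Definition funnel (alpha : rat) (j : nat) : edge :=
  iter j (funnel_step alpha) (f0, f1).

(* The number n of interior edges: n + 1 is the first j at which the mediant of
   e_j is alpha.  That mediant has denominator at least j + 2, so the search may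
   be limited to j < denq alpha. *)
Definition interior (alpha : rat) : nat :=
  (find (fun j => rat_of (apex (funnel alpha j)) == alpha)
        (iota 0 `|denq alpha|%N)).-1.

(** * The polynomials and the geometric root *)

Definition dQ (f : slope) : {poly int} := (-1) ^+ `|f.1|%N * 'X^(`|f.2|%N).

(* Only the values of Q on inQ0hat are constrained, and only they are used. *)
Definition is_calQ (Q : slope -> {poly int}) : Prop :=
  [/\ Q f0 = 1, Q finfty = 0, Q f1 = 1
    & forall beta gamma : slope,
        farey_pair beta gamma -> inQ0 (gamma + beta *+ 2) ->
        Q (gamma + beta *+ 2)
          = - dQ beta * Q gamma + Q beta * Q (gamma + beta)].

Definition peval (C : nzRingType) (p : {poly int}) (z : C) : C :=
  (map_poly intr p).[z].

(* The value at z of the rational function Z(e).  At a zero z of Q(e^R) the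
   conventions for division give the value 0, so such a z never satisfies
   Im Z(e)_z > 0. *)
Definition calZ (C : fieldType) (Q : slope -> {poly int}) (e : edge) (z : C) : C :=
  - peval (dQ (ehat e)) z ^ (- nu e)
  * (peval (Q e.1) z / peval (Q e.2) z) ^+ 2.

Definition geometric_root (R : realType) (Q : slope -> {poly int})
    (alpha : rat) : R[i] -> Prop :=
  unique (fun z : R[i] =>
    [/\ 0 < 'Im z,
        peval (Q (frac_of alpha)) z = 0
      & forall j : nat, (1 <= j <= interior alpha)%N ->
          0 < 'Im (calZ Q (funnel alpha j) z)]).

(** * The Sakuma-Weeks triangulation *)

(* The Gaussian integer x + iy is (x, y); a line of slope p/q has direction
   q + ip. *)
Definition gauss := (int * int)%type.
Definition dir (f : slope) : gauss := (f.2, f.1).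

(* a and b are the ends of an edge labeled f. *)
Definition joins (f : slope) (a b : gauss) : bool :=
  (b - a == dir f) || (a - b == dir f).

(* The edges of X_j, with slopes in s_j. *)
Definition Xedge (alpha : rat) (j : nat) (a b : gauss) : bool :=
  let e := funnel alpha j in
  [|| joins e.1 a b, joins e.2 a b | joins (apex e) a b].

(* Three such edges that close up have three different slopes, hence bound a
   triangle of X_j. *)
Definition Xtriangle (alpha : rat) (j : nat) (a b c : gauss) : bool :=
  [&& Xedge alpha j a b, Xedge alpha j b c & Xedge alpha j a c].

(* The vertices of the tetrahedron of the j-th layer that fills the
   parallelogram with corner P cut out by the lines of slopes e_j^L and e_j^R. *)
Definition tet_vertices (alpha : rat) (j : nat) (P : gauss) : seq gauss :=
  let u := dir (funnel alpha j).1 in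
  let v := dir (funnel alpha j).2 in
  [:: P; P + u; P + v; P + u + v].

(* The four vertices, in some order, of a tetrahedron of the j-th layer. *)
Definition ordered_tet (alpha : rat) (j : nat) (s : seq gauss) : Prop :=
  (1 <= j <= interior alpha)%N /\
  exists P : gauss, perm_eq s (tet_vertices alpha j P).

(* A point in a tetrahedron of the j-th layer is written as (j, l), where l is a
   formal convex combination of the vertices. *)
Definition point (R : realType) := (nat * seq (gauss * R))%type.

Definition weight (R : realType) (l : seq (gauss * R)) (x : gauss) : R :=
  \sum_(p <- l | p.1 == x) p.2.

Definition relocate (R : realType) (h : gauss -> gauss) (l : seq (gauss * R)) :
    seq (gauss * R) := [seq (h p.1, p.2) | p <- l].

(* M_alpha is the set M_points modulo the equivalence relation M_eq.  The strict
   bound on the weights removes the ideal vertices. *)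
Definition M_points (R : realType) (alpha : rat) (m : point R) : Prop :=
  [/\ (1 <= m.1 <= interior alpha)%N,
      exists P : gauss, forall p, p \in m.2 ->
        p.1 \in tet_vertices alpha m.1 P /\ 0 <= p.2,
      \sum_(p <- m.2) p.2 = 1
    & forall x : gauss, weight m.2 x < 1].

(* The gluings are: [glue_stack], along the triangulated surface X_j between the
   layers j and j + 1; [glue_rotation], by the generators x |-> 2a - x of Theta;
   [glue_top] and [glue_bottom], the folding of X_0 and X_n across the edges ab
   of the given label, which matches the triangle abc with the adjacent
   triangle, whose third vertex is a + b - c.  X_0 is the top of the first
   layer and X_n the bottom of the n-th. *)
Inductive glued (R : realType) (alpha : rat) : point R -> point R -> Prop :=
| glue_same j l l' :
    (forall x, weight l x = weight l' x) -> glued alpha (j, l) (j, l')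
| glue_stack j l :
    glued alpha (j, l) (j.+1, l)
| glue_rotation j (a : gauss) l :
    glued alpha (j, l) (j, relocate (fun x => a *+ 2 - x) l)
| glue_top a b c ta tb tc :
    Xtriangle alpha 0 a b c -> joins fhalf a b ->
    glued alpha (1%N, [:: (a, ta); (b, tb); (c, tc)])
                (1%N, [:: (a, ta); (b, tb); (a + b - c, tc)])
| glue_bottom a b c ta tb tc :
    Xtriangle alpha (interior alpha) a b c ->
    joins (ehat (funnel alpha (interior alpha).+1)) a b ->
    glued alpha (interior alpha, [:: (a, ta); (b, tb); (c, tc)])
                (interior alpha, [:: (a, ta); (b, tb); (a + b - c, tc)]).

Definition M_eq (R : realType) (alpha : rat) : point R -> point R -> Prop :=
  clos_refl_sym_trans (point R)
    (fun m m' => [/\ M_points alpha m, M_points alpha m' & glued alpha m m']).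

(** * Orientations *)

Definition zeta (C : fieldType) (t : C) : C := (1 - t)^-1.

(* The parameter at the edge ab of a tetrahedron of Delta_j, where e = e_j and
   t is the parameter at the edges labeled ehat e and apex e. *)
Definition edge_param (C : fieldType) (e : edge) (t : C) (a b : gauss) : C :=
  if joins e.1 a b then zeta t
  else if joins e.2 a b then zeta (zeta t)
  else t.

(* The ideal tetrahedron with vertices (0, infty, 1, w), Im w > 0, in this order
   is positively oriented and has parameters w, zeta w, zeta (zeta w) at the
   edges 0-infty, infty-1, infty-w; opposite edges have equal parameters.  So
   (v0, v1, v2, v3) is a positive order when these are the parameters at v0v1,
   v1v2, v1v3.  Asking this for all t, and not only for t = Z(e_j)_z, makes no
   difference unless t = zeta t, the regular tetrahedron, whose parameters do
   not determine the order; there the convention is the same as for other t. *)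
Definition positive_order (R : realType) (alpha : rat) (j : nat)
    (s : seq gauss) : Prop :=
  forall t : R[i], 0 < 'Im t ->
    let param k l := edge_param (funnel alpha j) t s`_k s`_l in
    param 1%N 2%N = zeta (param 0%N 1%N) /\
    param 1%N 3%N = zeta (zeta (param 0%N 1%N)).

(* f maps the tetrahedron of M_alpha with vertices s to that of M_beta with
   vertices s', affinely and respecting the order of the vertices. *)
Definition carries (R : realType) (alpha beta : rat) (f : point R -> point R)
    (j : nat) (s : seq gauss) (j' : nat) (s' : seq gauss) : Prop :=
  forall t : seq R, size t = 4%N -> M_points alpha (j, zip s t) ->
    M_eq beta (f (j, zip s t)) (j', zip s' t).

Definition orientation_reversing (R : realType) (alpha beta : rat)
    (f : point R -> point R) : Prop :=
  forall (j : nat) (s : seq gauss),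
    ordered_tet alpha j s -> positive_order R alpha j s ->
    exists (j' : nat) (s' : seq gauss),
      [/\ ordered_tet beta j' s', ~ positive_order R beta j' s'
        & carries alpha beta f j s j' s'].

(** * The reverse of alpha and the map phi_alpha *)

(* [0; a_1, ..., a_k] *)
Fixpoint contfrac (a : seq nat) : rat :=
  if a is x :: a' then (x%:R + contfrac a')^-1 else 0.

Definition is_reverse (alpha alphabar : rat) : Prop :=
  exists a : seq nat,
    [/\ all (leq 1) a, (2 <= head 0 a)%N, (2 <= last 0 a)%N,
        alpha = contfrac a & alphabar = contfrac (rev a)].

(* The linear map of Z[i] that takes lines of slope t to lines of slope
   phi_alpha(t) = (-s t + r) / (-q t + p), where alpha = p/q and
   r/s = e_{n+1}^-.  It is determined up to sign, and x |-> - x is in Theta. *)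
Definition phi_linear (alpha : rat) (x : gauss) : gauss :=
  let p := numq alpha in
  let q := denq alpha in
  let r := (eminus (funnel alpha (interior alpha).+1)).1 in
  let s := (eminus (funnel alpha (interior alpha).+1)).2 in
  (- q * x.2 + p * x.1, - s * x.2 + r * x.1).

(* The simplicial map induced on points of M_alpha. *)
Definition phi (R : realType) (alpha : rat) (m : point R) : point R :=
  (((interior alpha).+1 - m.1)%N, relocate (phi_linear alpha) m.2).

(* Main.v *)
Require Import Defs.
From HB Require Import structures.
From mathcomp Require Import all_boot all_order all_algebra.
From mathcomp Require Import archimedean reals trigo complex.
From mathcomp Require Import ring lra zify.

Set Implicit Arguments.
Unset Strict Implicit.
Unset Printing Implicit Defensive.

Import Order.TTheory GRing.Theory Num.Theory.
Local Open Scope ring_scope.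

(** Let W be the word of left and right turns that leads from e_0 down to
e_(n+1), so that alpha is the mediant of the last edge.  Since a continued
fraction lists the lengths of the runs of equal turns, the word of alphabar is
W read backwards, with left and right exchanged when the last turn of W is a
right turn ([reverse_words]); and phi_alpha preserves or exchanges the ends of
the edges accordingly ([phi_edge]).

Orientation.  The map phi_alpha turns the stack of layers upside down, and the
edges labeled e^L and e^R carry the parameters zeta t and zeta (zeta t).  If
phi_alpha preserves left and right ends, every edge keeps its parameter, so the
orientation is preserved; if it exchanges them, the orientation is reversed.  No
identification in M_alpha touches the interior of a tetrahedron except the
group Theta ([M_eq_copy]), so no other choice of image tetrahedra can change the
answer: phi_alpha reverses the orientation if and only if the last turn of W is
a right turn ([orientation_reversingP]).

Reversal of the roots.  Fix z and put q(f) = Q(f) / sqrt (d_Q(f)).  As d_Q is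
multiplicative, the recursion for Q becomes the trace identity
q(g + 2b) + q(g) = q(b) q(g + b), and its initial values put q on the Markov
surface x^2 + y^2 + w^2 = x y w ([markov_word]).  For the squares u = q^2 this
gives Z(e) = - u(e^L) / u(e^R) ([calZ_word]) and
u(ehat e) u(apex e) = (u(e^L) + u(e^R))^2 ([trace2_flip]).  Moreover
u(e^L) + u(e^R) = 0 for the first edge, because Q(infinity) = 0, and for the
last edge, because Q(alpha) = 0.  These relations form a system that is
symmetric under reading the funnel backwards ([folded_chain_rev]) and that
determines all values from the first one ([folded_chain_unique]).  So reading
the values of a root z backwards yields the values for alphabar at a root w,
and the normalization of the first values makes w = Z(e_n)_z, or its inverse if
left and right are exchanged.  In that case all shape parameters are inverted,
and a complex conjugation puts them back into the upper half-plane
([geometric_rev]).  The construction is an involution, hence carries the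
uniqueness of the root of Q(alpha) over to Q(alphabar).

The inequality.  A geometric root z always satisfies |z| <= 1, strictly if
n >= 2 ([angle_bound]).  Indeed z is the parameter of the first layer.  The
relations above say that the product of the parameters around each edge of the
triangulation is 1, so the dihedral angles around it add up to a positive
multiple of 2 pi; as the total angle is 2 pi per edge, the sum is 2 pi exactly.
For the edge class with the labels 0 and 1 this gives a + 2 b <= pi, where a and
b are the angles of the first layer at the labels 1 and 0, so that z / (1 - z)^2
has nonnegative imaginary part, which means |z| <= 1.  Applied to alphabar,
whose geometric root is zn or its inverse conjugate, this bound is the last
claim. *)

(** * Arguments of complex numbers and angles of ideal tetrahedra *)

Section Angles.
Variable R : realType.
Implicit Types (x y : R[i]) (theta : R).

(** The argument is a real number, not a class modulo 2 pi: sums of dihedral angles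
have to be compared with pi and 2 pi. *)
Definition has_arg theta x : Prop :=
  exists2 rho : R, 0 < rho & x = Complex (rho * cos theta) (rho * sin theta).

Lemma Im_gt0E x : (0 < 'Im x) = (0 < complex.Im x).
Proof. by rewrite -complexIm ltcR. Qed.

Lemma Im_ge0E x : (0 <= 'Im x) = (0 <= complex.Im x).
Proof. by rewrite -complexIm lecR. Qed.

Lemma has_argM theta theta' x y :
  has_arg theta x -> has_arg theta' y -> has_arg (theta + theta') (x * y).
Proof.
move=> [r r0 ->] [s s0 ->]; exists (r * s); first by apply: mulr_gt0.
rewrite cosD sinD; apply/eqP; rewrite eq_complex /=.
by apply/andP; split; apply/eqP; ring.
Qed.

Lemma has_arg0 : has_arg 0 1.
Proof. by exists 1 => //; rewrite cos0 sin0 mulr1 mulr0. Qed.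

Lemma has_arg_upper x :
  0 < 'Im x -> exists2 theta, 0 < theta < pi & has_arg theta x.
Proof.
rewrite Im_gt0E; case: x => a b /= b0.
have s0 : 0 < a ^+ 2 + b ^+ 2 by rewrite ltr_wpDl ?sqr_ge0 // exprn_gt0.
set rho := Num.sqrt (a ^+ 2 + b ^+ 2).
have rho0 : 0 < rho by rewrite sqrtr_gt0.
have rho2 : rho ^+ 2 = a ^+ 2 + b ^+ 2 by rewrite sqr_sqrtr // ltW.
have lt_rho : - rho < a < rho.
  have : `|a| < `|rho|.
    by rewrite -(ltr_pXn2r (n := 2)) ?nnegrE // !real_normK ?num_real // rho2
               ltrDl exprn_gt0.
  by rewrite (gtr0_norm rho0) ltr_norml.
have bd : -1 < a / rho < 1.
  by rewrite ltr_pdivlMr // ltr_pdivrMr // mulN1r mul1r.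
have bd' : -1 <= a / rho <= 1 by case/andP: bd => /ltW -> /ltW ->.
exists (acos (a / rho)).
  case/andP: bd => lo hi; rewrite acos_gt0 ?acos_ltpi //.
    by rewrite lo ltW.
  by rewrite (ltW lo).
exists rho => //; rewrite sin_acos // acosK ?itv_boundlr //.
have -> : 1 - (a / rho) ^+ 2 = (b / rho) ^+ 2.
  rewrite !expr_div_n rho2.
  by field; rewrite gt_eqF.
rewrite sqrtr_sqr ger0_norm ?divr_ge0 // ?ltW //.
by congr Complex; field; rewrite gt_eqF.
Qed.

Lemma has_arg_Im_ge0 theta x :
  has_arg theta x -> 0 < theta <= pi -> 0 <= 'Im x.
Proof.
move=> [r r0 ->] tp; rewrite Im_ge0E /=; apply: mulr_ge0; first exact: ltW.
case/andP: tp => t0; rewrite le_eqVlt => /orP[/eqP ->|tp]; first by rewrite sinpi lexx.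
by rewrite ltW // sin_gt0_pi // t0.
Qed.

Lemma has_arg_Im_gt0 theta x :
  has_arg theta x -> 0 < theta < pi -> 0 < 'Im x.
Proof. by move=> [r r0 ->] tp; rewrite Im_gt0E /= mulr_gt0 // sin_gt0_pi. Qed.

Lemma ge_pi_of_argN1 theta : has_arg theta (-1) -> 0 < theta -> pi <= theta.
Proof.
move=> ha t0; rewrite leNgt; apply/negP => tp.
have := has_arg_Im_gt0 ha; rewrite t0 tp => /(_ isT).
by rewrite Im_gt0E /= oppr0 ltxx.
Qed.

(** What turns a gluing equation into an angle inequality: a positive angle sum
whose parameters multiply to 1 is a positive multiple of 2 pi. *)
Lemma ge_2pi_of_arg1 theta : has_arg theta 1 -> 0 < theta -> pi *+ 2 <= theta.
Proof.
move=> [r r0 [er ei]] t0; rewrite leNgt; apply/negP => tp.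
have p0 := pi_gt0 R.
have [tpi|pit] := ltP theta pi.
  have : 0 < sin theta by rewrite sin_gt0_pi // t0.
  by move: ei => /esym/eqP; rewrite mulf_eq0 gt_eqF //= => /eqP ->; rewrite ltxx.
case: (eqVneq theta pi) => [e|ne].
  have : (1 : R) < 0.
    by rewrite er e cospi mulrN1 oppr_lt0.
  by rewrite ltr10.
have : 0 < sin (theta - pi).
  by rewrite sin_gt0_pi // subr_gt0 lt_neqAle eq_sym ne pit /= ltrBlDr -mulr2n.
move: ei => /esym/eqP; rewrite mulf_eq0 gt_eqF //= => /eqP s0.
by rewrite sinB s0 sinpi mul0r mulr0 subr0 ltxx.
Qed.

Lemma upper_neq0 x : 0 < 'Im x -> x != 0.
Proof. by apply: contraTneq => ->; rewrite raddf0 ltxx. Qed.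

Lemma upper_neq1 x : 0 < 'Im x -> 1 - x != 0.
Proof.
apply: contraTneq => /eqP; rewrite subr_eq0 => /eqP <-.
by rewrite Im_gt0E /= ltxx.
Qed.

Lemma ImV_lt0 x : 0 < 'Im x -> 'Im x^-1 < 0.
Proof.
move=> x0; have xn := upper_neq0 x0.
rewrite invC_norm; rewrite ImMl; last by rewrite realV realX // normr_real.
rewrite Im_conj mulrN oppr_lt0 mulr_gt0 // invr_gt0 exprn_gt0 //.
by rewrite normr_gt0.
Qed.

Lemma Im1 : 'Im (1 : R[i]) = 0.
Proof. by apply/Creal_ImP; rewrite rpred1. Qed.

Lemma upper_zeta x : 0 < 'Im x -> 0 < 'Im (1 - x)^-1.
Proof.
move=> x0; have := @ImV_lt0 (x - 1).
by rewrite raddfB /= Im1 subr0 -opprB invrN raddfN /= oppr_lt0; apply.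
Qed.

Lemma upper_zeta2 x : 0 < 'Im x -> 0 < 'Im (1 - x^-1).
Proof. by move=> x0; rewrite raddfB /= Im1 sub0r oppr_gt0 ImV_lt0. Qed.

(** The dihedral angles of an ideal tetrahedron at the edges with parameters x,
zeta x and zeta (zeta x). *)
Definition tet_args (a b c : R) x : Prop :=
  [/\ [/\ 0 < a, 0 < b & 0 < c], a + b + c = pi, has_arg a x,
      has_arg b (1 - x)^-1 & has_arg c (1 - x^-1)].

Lemma tet_argsP x : 0 < 'Im x -> exists a b c, tet_args a b c x.
Proof.
move=> x0; have [a /andP[a0 ap] ha] := has_arg_upper x0.
have [b /andP[b0 bp] hb] := has_arg_upper (upper_zeta x0).
have [c /andP[c0 cp] hc] := has_arg_upper (upper_zeta2 x0).
exists a, b, c; split=> //.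
(* The sum lies in ]0, 3 pi[ and has cosine -1 and sine 0. *)
have e : x * (1 - x)^-1 * (1 - x^-1) = -1.
  by field; rewrite upper_neq0 // upper_neq1.
have h := has_argM (has_argM ha hb) hc; rewrite e in h.
have ge := ge_pi_of_argN1 h ltac:(by rewrite !addr_gt0).
apply/eqP; rewrite eq_le ge andbT leNgt; apply/negP => gt.
have hN : has_arg (- pi) (-1).
  exists 1 => //; apply/eqP; rewrite eq_complex /= cosN sinN cospi sinpi.
  by rewrite !mul1r !oppr0 !eqxx.
have := has_argM h hN; rewrite mulrNN mulr1 => /ge_2pi_of_arg1.
rewrite subr_gt0 gt => /(_ isT).
move: ap bp cp; rewrite mulr2n; set p : R := pi; lra.
Qed.

End Angles.

(** * Folded chains and the angle sums around edges *)

(** The values l j, r j at the left and right ends of the edges e_0, ..., e_N of a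
funnel with turns d 0, ..., d (N - 1), where true is a turn to the left, which
keeps the left end.  In the last relation the two factors are the values at the
vertex that e_j has and e_(j+1) has not, and at the vertex that e_(j+2) adds to
e_(j+1): the relation is u(ehat e) u(apex e) = (u(e^L) + u(e^R))^2 at
e = e_(j+1).  The first two equations are the folding conditions at both ends. *)
Definition folded_chain (K : fieldType) (N : nat) (d : nat -> bool)
    (l r : nat -> K) : Prop :=
  [/\ l 0%N + r 0%N = 0, l N + r N = 0,
      forall j, (j < N)%N -> if d j then l j.+1 = l j else r j.+1 = r j
    & forall j, (j.+1 < N)%N ->
        (if d j then r j else l j) * (if d j.+1 then r j.+2 else l j.+2)
          = (l j.+1 + r j.+1) ^+ 2].

Section AngleSum.
Variable R : realType.
Implicit Types (x y : R[i]).

(** How the accumulated angles at the vertices of a triangle change when a layer is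
added below it.  For the triangle (l, t, r), with t the mediant, the product of
the parameters seen so far at a vertex is minus the quotient of the values at its
predecessor and at its successor in the cyclic order l, t, r.  This form is
preserved, because the parameters at l and t in the new layer are t / (l + t)
and (l + t) / l, each occurring twice around an edge, and (l + t)^2 = r t'.  The sign s allows for the vertex 0, whose
edges are joined to those labeled 1 by the folding. *)
Lemma layer_left (s l r t t' : R[i]) (tl tt a b c : R) :
  [/\ l != 0, r != 0, t != 0 & t' != 0] -> r * t' = (l + t) ^+ 2 ->
  tet_args a b c (- (l / t)) ->
  has_arg tl (s * - (r / t)) -> has_arg tt (- (l / r)) ->
  has_arg (tl + (b + b)) (s * - (t / t')) /\
  has_arg (tt + (c + c)) (- (t' / l)).
Proof.
move=> [l0 r0 t0 t'0] e [_ _ _ hb hc] hl ht.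
have lt0 : l + t != 0 by have := mulf_neq0 r0 t'0; rewrite e expf_eq0.
have et : t' = (l + t) ^+ 2 / r by rewrite -e; field.
split.
- have -> : s * - (t / t') = s * - (r / t) * ((1 - - (l / t))^-1 * (1 - - (l / t))^-1).
    by rewrite et; field; rewrite t0 r0 opprK addrC lt0.
  by apply: has_argM => //; apply: has_argM.
have -> : - (t' / l) = - (l / r) * ((1 - (- (l / t))^-1) * (1 - (- (l / t))^-1)).
    by rewrite et; field; rewrite l0 r0 t0.
by apply: has_argM => //; apply: has_argM.
Qed.

Lemma layer_right (l r t t' : R[i]) (tr tt a b c : R) :
  [/\ l != 0, r != 0, t != 0 & t' != 0] -> l * t' = (t + r) ^+ 2 ->
  tet_args a b c (- (t / r)) ->
  has_arg tr (- (t / l)) -> has_arg tt (- (l / r)) ->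
  has_arg (tt + (b + b)) (- (r / t')) /\
  has_arg (tr + (c + c)) (- (t' / t)).
Proof.
move=> [l0 r0 t0 t'0] e [_ _ _ hb hc] hr ht.
have lt0 : t + r != 0 by have := mulf_neq0 l0 t'0; rewrite e expf_eq0.
have et : t' = (t + r) ^+ 2 / l by rewrite -e; field.
split.
- have -> : - (r / t') = - (l / r) * ((1 - - (t / r))^-1 * (1 - - (t / r))^-1).
    by rewrite et; field; rewrite l0 r0 opprK addrC lt0.
  by apply: has_argM => //; apply: has_argM.
have -> : - (t' / t) = - (t / l) * ((1 - (- (t / r))^-1) * (1 - (- (t / r))^-1)).
    by rewrite et; field; rewrite l0 r0 t0.
by apply: has_argM => //; apply: has_argM.
Qed.

(** The value at the mediant of the edge e_j, which is an end of e_(j+1). *)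
Definition newval (d : nat -> bool) (l r : nat -> R[i]) (j : nat) :=
  if d j then r j.+1 else l j.+1.

(** The angles accumulated at the three vertices of the triangle below layer j.  The
first alternative holds while 0 is still a vertex, necessarily the left one; its
angle tl includes the angle of the first layer at the label 1, because folding
identifies the edges labeled 0 and 1, and that is the origin of the sign -1.  The
second alternative holds once 0 has been left behind, with an angle larger than
kappa.  Each layer adds 2 pi, and each vertex left behind after the first layer takes away
at least 2 pi, except 0; this accounts for the bounds on the sum. *)
Definition angle_inv (d : nat -> bool) (l r : nat -> R[i]) (kappa : R) (j : nat)
    (tl tr tt : R) : Prop :=
  let t := newval d l r j in
  [/\ [/\ 0 < tl, 0 < tr & 0 < tt], has_arg tr (- (t / l j)),
      has_arg tt (- (l j / r j))
    & [/\ forall i, (i < j)%N -> d i, has_arg tl (-1 * - (r j / t)),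
          tl + tr + tt <= pi *+ 2 & kappa < tl ?<= if (j <= 1)%N]
      \/ has_arg tl (1 * - (r j / t)) /\ tl + tr + tt + kappa < pi *+ 4].

(** Induction on the layers: the vertex left behind between two layers has
accumulated parameters with product 1, hence an angle of at least 2 pi. *)
Lemma angle_invP N d (l r : nat -> R[i]) z :
  folded_chain N d l r -> d 0%N -> l 0%N = z^-1 -> r 1%N = - z ^- 2 ->
  (forall j, (j <= N)%N -> l j != 0 /\ r j != 0) -> 0 < 'Im z ->
  (forall j, (0 < j < N)%N -> 0 < 'Im (- (l j / r j))) ->
  exists a b c, tet_args a b c z /\
    forall j, (0 < j < N)%N -> exists tl tr tt,
      angle_inv d l r (a + (b + b)) j tl tr tt.
Proof.
move=> [ends _ keep flip] d0 l0 r1 nz z0 up.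
have zn := upper_neq0 z0.
have [a [b [c habc]]] := tet_argsP z0; exists a, b, c; split=> //.
elim=> // -[|j] IH /andP[_ jN].
  exists (a + (b + b)), (0 + (c + c)), a.
  have [[a0 b0 c0] sum ha hb hc] := habc.
  have [l1 r1n] := nz 1%N (ltnW jN); have [l0n r0n] := nz 0%N isT.
  have er0 : r 0%N = - z^-1 by apply/eqP; rewrite -addr_eq0 addrC -l0 ends.
  have t1n : newval d l r 1 != 0.
    by have [l2 r2] := nz 2 jN; rewrite /newval; case: (d 1%N).
  have := keep 0%N (ltnW jN); rewrite d0 => e1.
  have := flip _ jN; rewrite -/(newval d l r 1) d0 e1 => fl.
  have [] := @layer_left (-1) _ _ _ _ a 0 a b c (And4 l0n r0n r1n t1n) fl.
  - by have -> : - (l 0%N / r 1%N) = z by rewrite l0 r1; field.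
  - by have -> : -1 * - (r 0%N / r 1%N) = z by rewrite er0 r1; field.
  - by rewrite er0 l0 divrN opprK divff ?invr_neq0 //; apply: has_arg0.
  move=> hl ht; split; rewrite ?e1 //; first by split; lra.
    by have -> : - (l 0%N / r 1%N) = z by rewrite l0 r1; field.
  left; split=> //; [by case| |exact: lexx].
  by move: sum; rewrite mulr2n; lra.
have {IH}[tl [tr [tt [[tl0 tr0 tt0] hr ht cases]]]] := IH (ltnW jN).
have [a' [b' [c' h']]] := tet_argsP (up j.+2 jN).
have [[a'0 b'0 c'0] sum' _ _ _] := h'.
have t0 : newval d l r j.+1 != 0.
  have [l2 r2] := nz j.+2 (ltnW jN).
  by rewrite /newval; case: (d j.+1).
have t'0 : newval d l r j.+2 != 0.
  have [l2 r2] := nz j.+3 jN.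
  by rewrite /newval; case: (d j.+2).
have [lj rj] := nz j.+1 (ltnW (ltnW jN)).
move: (keep _ (ltnW jN)) (flip _ jN) h'.
rewrite -/(newval d l r j.+2).
have := erefl (newval d l r j.+1); rewrite {2}/newval.
case: ifPn => dj et ej fl h'.
- rewrite -et ej in fl h'.
  have ha' : has_arg a' (- (l j.+1 / newval d l r j.+1)) by case: h'.
  have ge2 : pi *+ 2 <= tr + a'.
    apply: ge_2pi_of_arg1; last exact: addr_gt0.
    have -> : 1 = - (newval d l r j.+1 / l j.+1) * - (l j.+1 / newval d l r j.+1).
      by field; rewrite lj t0.
    exact: has_argM.
  have step s := @layer_left s _ _ _ _ tl tt _ _ _ (And4 lj rj t0 t'0) fl h'.
  exists (tl + (b' + b')), (tt + (c' + c')), a'.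
  rewrite /angle_inv -et ej.
  split; [by split; lra| |by []|].
    by case: cases => [[_ hl _ _]|[hl _]]; have [] := step _ hl ht.
  case: cases => [[alld hl le2 kap]|[hl le4]]; have [hl' _] := step _ hl ht.
    left; split=> //.
    - move=> i; rewrite ltnS leq_eqVlt => /orP[/eqP ->//|]; exact: alld.
    - by move: ge2 le2; rewrite mulr2n; lra.
    by move/lteifW: kap => /=; lra.
  by right; split=> //; move: ge2 le4; rewrite !mulrS mulr0n; lra.
rewrite -et ej in fl h'.
have ha' : has_arg a' (- (newval d l r j.+1 / r j.+1)) by case: h'.
have [hl' hr'] := layer_right (And4 lj rj t0 t'0) fl h' hr ht.
exists (tt + (b' + b')), (tr + (c' + c')), a'.
rewrite /angle_inv -et ej.
split; [by split; lra|by []|by []|right; rewrite mul1r; split=> //].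
case: cases => [[_ _ le2 kap]|[hl le4]].
  by move/lteifW: kap => /=; move: le2; rewrite !mulrS mulr0n; lra.
have ge2 : pi *+ 2 <= tl + a'.
  apply: ge_2pi_of_arg1; last exact: addr_gt0.
  have -> : 1 = 1 * - (r j.+1 / newval d l r j.+1) * - (newval d l r j.+1 / r j.+1).
    by field; rewrite rj t0.
  exact: has_argM.
by move: ge2 le4; rewrite !mulrS mulr0n; lra.
Qed.

Lemma Im_div_sqr1B (z : R[i]) : 1 - z != 0 ->
  'Im (z * ((1 - z)^-1 * (1 - z)^-1))
    = 'Im z * (1 - `|z| ^+ 2) / (`|1 - z| ^+ 2) ^+ 2.
Proof.
move=> z1; have c1 : 1 - z^* != 0 by rewrite -[1]conjC1 -rmorphB conjC_eq0.
rewrite !normCK !ImE !rmorphM !fmorphV !rmorphB rmorph1.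
by field; rewrite z1 c1.
Qed.

(** At the last edge the folding condition makes the angle at the remaining vertex
at least 2 pi, or pi if it is 0, and those at the two ends together at least pi.
Against the upper bounds of [angle_inv] this leaves a + 2 b <= pi for the angles
a and b of the first layer at the labels 1 and 0, with strict inequality as soon
as a second layer contributes. *)
Lemma angle_bound N d (l r : nat -> R[i]) z :
  folded_chain N d l r -> d 0%N -> l 0%N = z^-1 -> r 1%N = - z ^- 2 ->
  (forall j, (j <= N)%N -> l j != 0 /\ r j != 0) -> 0 < 'Im z ->
  (forall j, (0 < j < N)%N -> 0 < 'Im (- (l j / r j))) ->
  (exists2 i, (i < N)%N & ~~ d i) ->
  `|z| < 1 ?<= if (N <= 2)%N.
Proof.
move=> fc d0 l0 r1 nz z0 up [i0 i0N di0].
have [a [b [c [habc inv]]]] := angle_invP fc d0 l0 r1 nz z0 up.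
have [[a0 b0 c0] _ ha hb _] := habc.
suff kap : a + (b + b) < pi ?<= if (N <= 2)%N.
  have z1 := upper_neq1 z0.
  have h := has_argM ha (has_argM hb hb).
  have k0 : 0 < a + (b + b) by rewrite !addr_gt0.
  have d2 : 0 < (`|1 - z| ^+ 2) ^+ 2 by rewrite !exprn_gt0 // normr_gt0.
  case: (N <= 2)%N kap => /= kap.
    have := has_arg_Im_ge0 h; rewrite k0 kap => /(_ isT).
    rewrite Im_div_sqr1B // pmulr_lge0 ?invr_gt0 // pmulr_rge0 //.
    by rewrite subr_ge0 expr_le1.
  have := has_arg_Im_gt0 h; rewrite k0 kap => /(_ isT).
  rewrite Im_div_sqr1B // pmulr_lgt0 ?invr_gt0 // pmulr_rgt0 //.
  by rewrite subr_gt0 expr_lt1.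
have [_ endN keep _] := fc.
have N1 : (1 < N)%N.
  by case: i0 i0N di0 => [|i] iN; [rewrite d0 | move=> _; case: N iN {fc nz up inv endN keep} => // -[]].
case: N N1 fc nz up i0N inv endN keep => // -[//|n] _ fc nz up i0N inv endN keep.
have [tl [tr [tt [[tl0 tr0 tt0] hr ht cases]]]] := inv n.+1 (leqnn _).
have [lj rj] := nz n.+1 (leqnSn _).
have [lN rN] := nz n.+2 (leqnn _).
have t0 : newval d l r n.+1 != 0 by rewrite /newval; case: (d n.+1).
have := erefl (newval d l r n.+1); rewrite {2}/newval.
have := keep _ (leqnn n.+2); case: ifPn => dn en et.
- have e1 : newval d l r n.+1 = - l n.+1.
    by apply/eqP; rewrite et -addr_eq0 addrC -en endN.
  have ge2 : pi *+ 2 <= tr.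
    by apply: ge_2pi_of_arg1 => //; rewrite e1 mulNr divff // opprK in hr.
  case: cases => [[alld _ _ _]|[hl le4]].
    have : (i0 < n.+2)%N by [].
    rewrite ltnS leq_eqVlt => /orP[/eqP i0n|/alld i0d].
      by rewrite i0n dn in di0.
    by rewrite i0d in di0.
  have ge1 : pi <= tl + tt.
    apply: ge_pi_of_argN1; last exact: addr_gt0.
    have -> : -1 = 1 * - (r n.+1 / newval d l r n.+1) * - (l n.+1 / r n.+1).
      by rewrite e1; field; rewrite lj rj.
    exact: has_argM.
  by apply: ltrW_lteif; move: ge1 ge2 le4; rewrite !mulrS mulr0n; lra.
have e1 : newval d l r n.+1 = - r n.+1.
  by apply/eqP; rewrite et -addr_eq0 -en endN.
have ge1 : pi <= tt + tr.
  apply: ge_pi_of_argN1; last exact: addr_gt0.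
  have -> : -1 = - (l n.+1 / r n.+1) * - (newval d l r n.+1 / l n.+1).
    by rewrite e1; field; rewrite lj rj.
  exact: has_argM.
have er : r n.+1 / newval d l r n.+1 = -1 by rewrite e1; field.
case: cases => [[_ hl le2 kap]|[hl le4]].
  have gel : pi <= tl.
    apply: ge_pi_of_argN1 => //.
    by rewrite er opprK mulr1 in hl.
  have lel : tl <= pi by move: le2; rewrite !mulrS mulr0n; lra.
  by have := lteif_trans kap (lel : tl < pi ?<= if true); rewrite andbT.
have ge2 : pi *+ 2 <= tl.
  apply: ge_2pi_of_arg1 => //.
  by rewrite er opprK mulr1 in hl.
by apply: ltrW_lteif; move: ge1 ge2 le4; rewrite !mulrS mulr0n; lra.
Qed.

End AngleSum.

(** * Words of turns, funnels and continued fractions *)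

Definition edge_step (e : edge) (b : bool) : edge :=
  if b then (e.1, apex e) else (apex e, e.2).

Definition word_edge (W : seq bool) : edge := foldl edge_step (f0, f1) W.

#[local] Arguments apex : simpl never.

Lemma apexE (e : edge) : apex e = (e.1.1 + e.2.1, e.1.2 + e.2.2).
Proof. by []. Qed.

Definition unimodular (e : edge) : Prop :=
  [/\ e.2.1 * e.1.2 - e.1.1 * e.2.2 = 1, 0 <= e.1.1 <= e.1.2,
      0 < e.2.1 <= e.2.2 & 0 < e.1.2].

Lemma unimodular_step e b : unimodular e -> unimodular (edge_step e b).
Proof.
case: e => [[a1 a2] [b1 b2]]; rewrite /unimodular /edge_step apexE.
by case: b => /= -[*]; split; nia.
Qed.

Lemma word_edge_rcons W b : word_edge (rcons W b) = edge_step (word_edge W) b.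
Proof. by rewrite /word_edge foldl_rcons. Qed.

Lemma word_edge_take W j : (j < size W)%N ->
  word_edge (take j.+1 W) = edge_step (word_edge (take j W)) (nth false W j).
Proof. by move=> jW; rewrite (take_nth false) // word_edge_rcons. Qed.

Lemma unimodular_word W : unimodular (word_edge W).
Proof.
elim/last_ind: W => [|W b IH]; first by [].
by rewrite word_edge_rcons; apply: unimodular_step.
Qed.

Lemma inQ0_unimodular e : unimodular e -> [/\ inQ0 e.1, inQ0 e.2 & inQ0 (apex e)].
Proof.
case: e => [[a1 a2] [b1 b2]]; rewrite /unimodular /inQ0 apexE => /= -[*].
by split; apply/and4P; split; try lia; apply/coprimezP;
  [exists (- b2, b1)|exists (a2, - a1)|exists (a2, - a1)] => /=; nia.
Qed.

(** The mediants have growing denominators; so the search that defines the number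
of interior edges ranges far enough. *)
Lemma apex_den_word W : (size W).+2%:Z <= (apex (word_edge W)).2.
Proof.
elim/last_ind: W => [|W b]; first by [].
rewrite word_edge_rcons size_rcons; have := unimodular_word W.
case: (word_edge W) => [[a1 a2] [b1 b2]].
by rewrite /unimodular /edge_step !apexE; case: b => /= -[*]; lia.
Qed.

Lemma rat_of_lt (f g : slope) : 0 < f.2 -> 0 < g.2 ->
  (rat_of f < rat_of g) = (f.1 * g.2 < g.1 * f.2).
Proof.
move=> f0 g0; rewrite /rat_of ltr_pdivrMr ?ltr0z // mulrAC ltr_pdivlMr ?ltr0z //.
by rewrite -!intrM ltr_int.
Qed.

Lemma frac_of_rat_of f : inQ0 f -> frac_of (rat_of f) = f.
Proof.
case: f => p q /and4P[/= q0 p0 pq cop]; rewrite /frac_of /rat_of /=.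
have cop' : coprime `|p| `|q| by [].
rewrite coprimeq_num // coprimeq_den // (gt_eqF q0) gtr0_sg // mul1r.
by rewrite gtr0_norm.
Qed.

Lemma apex_foldl V (e : edge) : exists x y : int,
  [/\ 0 < x, 0 < y, (apex (foldl edge_step e V)).1 = x * e.1.1 + y * e.2.1
    & (apex (foldl edge_step e V)).2 = x * e.1.2 + y * e.2.2].
Proof.
elim: V e => [|b V IH] e; first by exists 1, 1; rewrite !mul1r.
have [x [y [x0 y0 E1 E2]]] := IH (edge_step e b).
rewrite [foldl _ _ _]/(foldl edge_step (edge_step e b) V) E1 E2 /edge_step.
case: b {E1 E2} => /=.
  by exists (x + y), y; split; lia.
by exists x, (x + y); split; lia.
Qed.

(** All later mediants stay on the side of a mediant to which the path turns there;
so the word is the path that the funnel of its last mediant takes. *)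
Lemma word_apex_cmp W j : (j < size W)%N ->
  if nth false W j
  then rat_of (apex (word_edge W)) < rat_of (apex (word_edge (take j W)))
  else rat_of (apex (word_edge (take j W))) < rat_of (apex (word_edge W)).
Proof.
move=> jW; set f := apex (word_edge (take j W)); set g := apex (word_edge W).
have [_ _ If] := inQ0_unimodular (unimodular_word (take j W)).
have [_ _ Ig] := inQ0_unimodular (unimodular_word W).
have {If}f0 : 0 < f.2 by case/and4P: If.
have {Ig}g0 : 0 < g.2 by case/and4P: Ig.
rewrite !rat_of_lt //.
have eg : g = apex (foldl edge_step (word_edge (take j.+1 W)) (drop j.+1 W)).
  by rewrite /g -{1}(cat_take_drop j.+1 W) /word_edge foldl_cat.
have [x [y [x0 y0]]] := apex_foldl (drop j.+1 W) (word_edge (take j.+1 W)).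
rewrite -eg word_edge_take // => -> ->.
rewrite /f; have := unimodular_word (take j W).
case: (word_edge _) => [[a1 a2] [b1 b2]]; rewrite /unimodular /edge_step !apexE /=.
move=> [] det *.
case: (nth false W j) => /=.
  suff : (a1 + b1) * (x * a2 + y * (a2 + b2)) - (x * a1 + y * (a1 + b1)) * (a2 + b2) = x * (b1 * a2 - a1 * b2) by rewrite det; lia.
  by ring.
suff : (x * (a1 + b1) + y * b1) * (a2 + b2) - (a1 + b1) * (x * (a2 + b2) + y * b2) = y * (b1 * a2 - a1 * b2) by rewrite det; lia.
by ring.
Qed.

Section FunnelOfWord.
Variables (W : seq bool) (alpha : rat).
Hypothesis alphaE : alpha = rat_of (apex (word_edge W)).

Lemma frac_of_word : frac_of alpha = apex (word_edge W).
Proof.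
have [_ _ I] := inQ0_unimodular (unimodular_word W).
by rewrite alphaE frac_of_rat_of.
Qed.

Lemma funnel_word j : (j <= size W)%N -> funnel alpha j = word_edge (take j W).
Proof.
elim: j => [|j IH] jW; first by rewrite take0.
rewrite word_edge_take // /funnel iterS -/(funnel alpha j) IH; last exact: ltnW.
rewrite /funnel_step alphaE; have := word_apex_cmp jW.
by case: (nth false W j) => [->|/ltW]; [|rewrite leNgt => /negbTE ->].
Qed.

Lemma interior_word : interior alpha = (size W).-1.
Proof.
have den : `|denq alpha|%N = `|(apex (word_edge W)).2|%N by rewrite -frac_of_word.
have ltden : (size W < `|denq alpha|)%N.
  by rewrite den; have := apex_den_word W; lia.
rewrite /interior; congr predn.
set p := fun j => _.
have pW : p (size W) by rewrite /p funnel_word // take_size -alphaE.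
have pN j : (j < size W)%N -> p j = false.
  move=> jW; rewrite /p funnel_word ?(ltnW jW) // alphaE.
  have := word_apex_cmp jW.
  by case: ifP => _; [move/gt_eqF|move/lt_eqF].
rewrite -(subnKC (ltnW ltden)) iotaD find_cat size_iota.
case: hasP => [[j]|_].
  by rewrite mem_iota add0n => /andP[_ /pN ->].
by have := ltden; rewrite -subn_gt0 add0n; case: (_ - _)%N => //= m _; rewrite pW addn0.
Qed.

End FunnelOfWord.

Definition swap_sides (s : bool) (e : edge) : edge := if s then (e.2, e.1) else e.

Definition ends_right (W : seq bool) : bool := ~~ last true W.

(** The path of the reverse; it has to begin with a left turn, like that of every
fraction below 1/2. *)
Definition rev_word (W : seq bool) : seq bool :=
  rev (map (addb (ends_right W)) W).

Lemma size_rev_word W : size (rev_word W) = size W.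
Proof. by rewrite size_rev size_map. Qed.

Lemma nth_rev_word W i : (i < size W)%N ->
  nth false (rev_word W) i = ends_right W (+) nth false W (size W - i.+1).
Proof.
move=> iW; rewrite nth_rev size_map // (nth_map false) //.
by rewrite ltn_subrL (leq_ltn_trans _ iW).
Qed.

Lemma ends_right_rev W : head false W -> ends_right (rev_word W) = ends_right W.
Proof.
case: W => //= -[] // W _.
by rewrite /rev_word /= rev_cons /ends_right last_rcons addbT negbK.
Qed.

Lemma rev_wordK W : head false W -> rev_word (rev_word W) = W.
Proof.
move=> hW; rewrite /rev_word -/(rev_word W) ends_right_rev // /rev_word map_rev revK.
by rewrite -map_comp (eq_map (g := id)) ?map_id // => b /=; rewrite addKb.
Qed.

Lemma head_rev_word W : (0 < size W)%N -> head false (rev_word W).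
Proof.
move=> W0; rewrite -nth0 nth_rev_word // subn1 nth_last /ends_right.
by case: W W0 => // b W _ /=; rewrite addNb addbb.
Qed.

Section PhiOnEdges.
Variables (W : seq bool) (alpha : rat).
Hypotheses (W0 : (0 < size W)%N) (alphaE : alpha = rat_of (apex (word_edge W))).
Let s := ends_right W.

Lemma phi_linearD x y : phi_linear alpha (x + y) = phi_linear alpha x + phi_linear alpha y.
Proof. by rewrite /phi_linear; congr pair => /=; ring. Qed.

Lemma phi_linearN x : phi_linear alpha (- x) = - phi_linear alpha x.
Proof. by rewrite /phi_linear; congr pair => /=; ring. Qed.

Lemma phi_last_edge :
  let e := word_edge W in let e' := swap_sides s (f0, f1) in
  phi_linear alpha (dir e.1) = dir e'.1 /\ phi_linear alpha (dir e.2) = - dir e'.2.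
Proof.
rewrite /s /phi_linear (interior_word alphaE) prednK // (funnel_word alphaE) // take_size.
have := frac_of_word alphaE; rewrite /frac_of => -[-> ->].
case/lastP: W W0 => // V b _; rewrite word_edge_rcons /ends_right last_rcons.
have := unimodular_word V; case: (word_edge V) => [[a1 a2] [b1 b2]].
rewrite /unimodular /edge_step !apexE => /= -[det] La Lb a20.
case: b; rewrite /eminus /swap_sides /dir /=.
  have -> : a2 < a2 + b2 by lia.
  by rewrite /= -[- (1, 1)]/(-1, -1); split; congr pair; nia.
have -> : (a2 + b2 < b2) = false by lia.
by rewrite /= -[- (1, 0)]/(-1, 0); split; congr pair; nia.
Qed.

(** The linear map takes the edges of the funnel to those of the reversed word, in
reverse order.  Undoing a left turn replaces the right end R by R - L, and as the
images of L and R have opposite signs, the image of R - L is again a mediant. *)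
Lemma phi_edge i : (i <= size W)%N ->
  let e := word_edge (take (size W - i) W) in
  let e' := swap_sides s (word_edge (take i (rev_word W))) in
  phi_linear alpha (dir e.1) = dir e'.1 /\ phi_linear alpha (dir e.2) = - dir e'.2.
Proof.
elim: i => [_|i IH iW]; first by rewrite subn0 take_size take0; apply: phi_last_edge.
have [] := IH (ltnW iW).
rewrite (word_edge_take (j := i)) ?size_rev_word // nth_rev_word // -/s.
rewrite subnS -{1 2}(prednK (n := size W - i)) ?subn_gt0 // -subnS.
rewrite word_edge_take ?ltn_subrL ?(leq_ltn_trans _ iW) //.
set b := nth _ _ _; set e := word_edge _; set e' := word_edge _.
have eD (x y : slope) : dir (x + y) = dir x + dir y by [].
case: b; case: s; rewrite /edge_step /swap_sides /apex /= !eD phi_linearD => h1 h2;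
  split=> //.
- by rewrite -[LHS](addKr (phi_linear alpha (dir e.1))) h2 h1 opprD addrC.
- by rewrite -[LHS](addKr (phi_linear alpha (dir e.1))) h2 h1 opprD.
- by rewrite -[LHS](addrK (phi_linear alpha (dir e.2))) h1 h2 opprK addrC.
by rewrite -[LHS](addrK (phi_linear alpha (dir e.2))) h1 h2 opprK.
Qed.

End PhiOnEdges.

(** The turns that lead to a continued fraction from the edge with ends 0 and
infinity: a term is the length of a run of equal turns. *)
Fixpoint blocks (b : bool) (a : seq nat) : seq bool :=
  if a is x :: a' then nseq x b ++ blocks (~~ b) a' else [::].

Lemma blocks_rcons b a x :
  blocks b (rcons a x) = blocks b a ++ nseq x (b (+) odd (size a)).
Proof.
elim: a b => [|y a IH] b /=; first by rewrite addbF cats0.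
by rewrite IH catA addNb addbN.
Qed.

Lemma rev_blocks b a : rev (blocks b a) = blocks (b (+) ~~ odd (size a)) (rev a).
Proof.
elim: a b => [|x a IH] b //=.
rewrite rev_cat IH rev_nseq rev_cons blocks_rcons size_rev.
by rewrite negbK addNb addbN negbK -addbA addbb addbF.
Qed.

Lemma map_addb_blocks s b a : map (addb s) (blocks b a) = blocks (s (+) b) a.
Proof. by elim: a b => [|x a IH] b //=; rewrite map_cat map_nseq IH addbN. Qed.

Lemma foldl_nseq_left x (u v : slope) :
  foldl edge_step (u, v) (nseq x true) = (u, v + u *+ x).
Proof.
elim: x v => [|x IH] v; first by rewrite /= addr0.
by rewrite -[LHS]/(foldl edge_step (u, u + v) (nseq x true)) IH mulrS addrA [u + v]addrC.
Qed.

Lemma foldl_nseq_right x (u v : slope) :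
  foldl edge_step (u, v) (nseq x false) = (u + v *+ x, v).
Proof.
elim: x u => [|x IH] u; first by rewrite /= addr0.
by rewrite -[LHS]/(foldl edge_step (u + v, v) (nseq x false)) IH mulrS addrA.
Qed.

(** The end of an edge that was added by the last turn, given its direction. *)
Definition newest (left : bool) (e : edge) : slope := if left then e.2 else e.1.

(** The word of a continued fraction, read from an arbitrary edge, ends at the
combination of the ends of that edge given by its numerator and denominator.
The two directions play symmetric roles, which makes the induction on the terms
possible: prepending a term x to the fraction p / q gives q / (p + x q). *)
Lemma contfrac_blocks a : all (leq 1) a -> exists p q : nat,
  [/\ (0 < q)%N, contfrac a = p%:R / q%:R
    & forall b (e : edge),
        newest (~~ b (+) odd (size a)) (foldl edge_step e (blocks b a))
          = newest b e *+ p + newest (~~ b) e *+ q].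
Proof.
elim: a => [_|x a IH /= /andP[x1 /IH [p [q [q0 ea IHa]]]]].
  by exists 0%N, 1%N; split=> // -[] e /=; rewrite add0r.
have d0 : (0 < p + x * q)%N by rewrite addn_gt0 muln_gt0 x1 q0 orbT.
exists q, (p + x * q)%N; split=> //.
  rewrite ea; have qn : q%:R != 0 :> rat by rewrite pnatr_eq0 -lt0n.
  have dn : (p + x * q)%:R != 0 :> rat by rewrite pnatr_eq0 -lt0n.
  rewrite -[RHS]invf_div; congr (_^-1).
  by rewrite natrD natrM; field.
move=> b [u v]; rewrite foldl_cat addbN -addNb IHa.
case: b; rewrite ?foldl_nseq_left ?foldl_nseq_right /=;
  by rewrite mulrnDl mulrnDr mulrnA addrCA.
Qed.

(** The full word of a continued fraction starts from the edge with ends 0 and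
infinity.  Its first turn leads to the edge with ends 0 and 1, and its last
letter only selects the mediant of the edge reached before. *)
Lemma contfrac_word a W :
  all (leq 1) a -> blocks true a = true :: rcons W (odd (size a)) ->
  contfrac a = rat_of (apex (word_edge W)).
Proof.
move=> a1 eB; have [p [q [q0 -> h]]] := contfrac_blocks a1.
have := h true (f0, finfty); rewrite eB addFb.
rewrite -[foldl _ _ _]/(word_edge (rcons W (odd (size a)))) word_edge_rcons.
set e := word_edge W.
have -> : newest (odd (size a)) (edge_step e (odd (size a))) = apex e.
  by case: (odd _).
move->; rewrite /rat_of.
have mulnS (k : nat) (x y : int) : (x, y) *+ k = (x *+ k, y *+ k).
  by elim: k => // k IH; rewrite !mulrS IH.
by rewrite !mulnS /= !mul0rn addr0 add0r !natz.
Qed.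

(** The first and the last letter of the word of alpha are dropped, as the funnel
starts at the edge with ends 0 and 1 and ends at one with mediant alpha.
Reversing the terms reverses the word up to the choice of the first direction.
As 1 / alpha is not an integer there are at least two runs, hence a right turn. *)
Lemma reverse_words alpha alphabar : is_reverse alpha alphabar ->
  alpha^-1 \isn't a Num.int ->
  exists W, [/\ alpha = rat_of (apex (word_edge W)),
    alphabar = rat_of (apex (word_edge (rev_word W))), head false W & false \in W].
Proof.
case=> a [a1 ha la -> ->] nint.
case: a a1 ha la nint => [//|x [|y a]] a1 ha la.
  by rewrite /= addr0 invrK => /negP[]; apply: rpred_nat.
move=> _; have [x0 ex] : exists x0, x = x0.+2.
  by case: x ha {a1 la} => [|[|x0]] // _; exists x0.
set A := [:: x, y & a].
have [z [A' eA]] : exists z A', A = rcons A' z.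
  by exists (last y a), (x :: belast y a); rewrite /A lastI.
have z2 : (2 <= z)%N by move: la; rewrite -/A eA last_rcons.
have [A0 oA] : (0 < size A')%N /\ odd (size A) = ~~ odd (size A').
  by split; [have := congr1 size eA; rewrite size_rcons => -[<-]|rewrite eA size_rcons].
have [W eB [hW lW]] : exists2 W, blocks true A = true :: rcons W (odd (size A))
    & head false W /\ last true W = odd (size A).
  have eB := blocks_rcons true A' z; rewrite -eA addTb -oA in eB.
  case: z z2 eA eB => [//|[//|z]] _ eA eB.
  have eB' : blocks true A = rcons (rcons (blocks true A' ++ nseq z (odd (size A))) (odd (size A))) (odd (size A)).
    rewrite eB -!cats1 -!catA; congr (_ ++ _).
    by rewrite -[z.+2]addn2 nseqD.
  have [C eC] : exists C, blocks true A' = [:: true, true & C].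
    case: (A') A0 eA => // x' A'' _ [<- _].
    by rewrite ex /=; eexists.
  rewrite eC /= in eB'.
  exists (true :: rcons (C ++ nseq z (odd (size A))) (odd (size A))); first exact: eB'.
  by rewrite /= last_rcons.
exists W; split=> //.
- exact: contfrac_word.
- have er : ends_right W = ~~ odd (size A) by rewrite /ends_right lW.
  apply: contfrac_word; first by rewrite all_rev.
  have -> : blocks true (rev A) = rev (map (addb (ends_right W)) (blocks true A)).
    by rewrite map_addb_blocks rev_blocks er addbT negbK addbN addbb.
  rewrite eB /= map_rcons rev_cons rev_rcons /= er addNb addbb size_rev.
  by rewrite addbT negbK /rev_word er.
have : false \in blocks true A.
  rewrite /A /= !mem_cat !mem_nseq eqxx.
  by case/and3P: a1 => _ -> _; rewrite !andbT orbT.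
rewrite eB; move: (odd (size A)) lW => o lW; rewrite inE mem_rcons inE /=.
case/orP => // /eqP fo; rewrite -fo in lW.
case: W hW lW {eB} => //= -[] // W _ lW.
by rewrite inE /= -lW; case: W lW => //= b W lW; rewrite mem_last.
Qed.

(** * Squared normalized traces *)

Section Values.
Variables (C : fieldType) (Q : slope -> {poly int}).
Hypothesis calQ : is_calQ Q.
Implicit Types (z : C) (f g : slope).

Definition value_d z f : C := peval (dQ f) z.
Definition value_Q z f : C := peval (Q f) z.

Lemma value_dE z f : value_d z f = (-1) ^+ `|f.1|%N * z ^+ `|f.2|%N.
Proof.
by rewrite /value_d /peval /dQ rmorphM rmorphXn /= map_polyXn rmorphN1 hornerM
           -polyCN -polyC_exp hornerC hornerXn.
Qed.

Lemma value_dD z f g : 0 <= f.1 -> 0 <= g.1 -> 0 <= f.2 -> 0 <= g.2 ->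
  value_d z (f + g) = value_d z f * value_d z g.
Proof.
case: f g => [[a|a] [b|b]] [[c|c] [d|d]] //= _ _ _ _.
by rewrite !value_dE /= !exprD mulrACA.
Qed.

Lemma value_d_neq0 z f : z != 0 -> value_d z f != 0.
Proof. by move=> z0; rewrite value_dE; apply: mulf_neq0; rewrite ?signr_eq0 ?expf_neq0. Qed.

Lemma value_Q_mediant z beta gamma :
  farey_pair beta gamma -> inQ0 (gamma + beta *+ 2) ->
  value_Q z (gamma + beta *+ 2)
    = - value_d z beta * value_Q z gamma
      + value_Q z beta * value_Q z (gamma + beta).
Proof.
case: calQ => _ _ _ rec fp I; rewrite /value_Q (rec _ _ fp I).
rewrite /value_d /peval; move: (dQ beta) => D; rewrite rmorphD !rmorphM rmorphN /=.
by rewrite hornerD !hornerM hornerN.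
Qed.

Lemma value_Q0 z : value_Q z f0 = 1.
Proof. by case: calQ => e _ _ _; rewrite /value_Q e /peval rmorph1 hornerC. Qed.

Lemma value_Q1 z : value_Q z f1 = 1.
Proof. by case: calQ => _ _ e _; rewrite /value_Q e /peval rmorph1 hornerC. Qed.

Lemma value_Qhalf z : value_Q z fhalf = 1.
Proof.
have := @value_Q_mediant z f0 finfty isT isT.
rewrite -[finfty + _ *+ _]/fhalf -[finfty + _]/f1 => ->.
case: calQ => _ e _ _; rewrite value_Q0 value_Q1 /value_Q e /peval rmorph0 horner0.
by rewrite mulr0 add0r mulr1.
Qed.

(** The Markov equation for the normalized traces at the ends and at the mediant of
e, multiplied by the value of d_Q at the mediant. *)
Definition markov z (e : edge) : Prop :=
  value_Q z e.1 ^+ 2 * value_d z e.2 + value_Q z e.2 ^+ 2 * value_d z e.1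
    + value_Q z (apex e) ^+ 2
  = value_Q z e.1 * value_Q z e.2 * value_Q z (apex e).

(** The recursion for Q at a turn: gamma is the end that is left behind, and beta,
the end that both edges share, is the one of smaller denominator in e'. *)
Lemma value_Q_step z e b : unimodular e ->
  let e' := edge_step e b in
  let beta := if b then e.1 else e.2 in
  let gamma := if b then e.2 else e.1 in
  value_Q z (apex e') = - value_d z beta * value_Q z gamma
     + value_Q z beta * value_Q z (apex e).
Proof.
move=> ue e' beta gamma.
have [I1 I2 _] := inQ0_unimodular ue.
have [_ _ Ia] := inQ0_unimodular (unimodular_step b ue).
have eD : gamma + beta = apex e by rewrite /gamma /beta; case: b {e' beta gamma Ia}; rewrite // addrC.
have eA : gamma + beta *+ 2 = apex e'.
  rewrite mulr2n addrA eD /e' /edge_step /beta.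
  by case: b {e' beta gamma Ia eD}; rewrite // addrC.
have := @value_Q_mediant z beta gamma; rewrite eD eA; apply; last exact: Ia.
case: ue => det _ _ _; apply/and3P.
by rewrite /beta /gamma /inQ0hat; case: b {e' beta gamma Ia eD eA};
  rewrite I1 I2; split=> //; lia.
Qed.

Lemma value_d_apex z e : unimodular e ->
  value_d z (apex e) = value_d z e.1 * value_d z e.2.
Proof. by case=> _ /andP[? ?] /andP[? ?] ?; rewrite /apex value_dD //; lia. Qed.

(** Up to factors d_Q, the new value and the value that it replaces are the two roots
of one quadratic equation. *)
Lemma markov_step z e b : unimodular e -> markov z e -> markov z (edge_step e b).
Proof.
move=> ue; have := value_Q_step z b ue; have := value_d_apex z ue; rewrite /markov.
case: b => /= -> ->; set qA := value_Q z (apex e);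
set q1 := value_Q z e.1; set q2 := value_Q z e.2;
set d1 := value_d z e.1; set d2 := value_d z e.2 => M.
  apply/eqP; rewrite -subr_eq0; apply/eqP.
  transitivity (d1 * ((q1 ^+ 2 * d2 + q2 ^+ 2 * d1 + qA ^+ 2) - q1 * q2 * qA)).
    by ring.
  by rewrite M subrr mulr0.
apply/eqP; rewrite -subr_eq0; apply/eqP.
transitivity (d2 * ((q1 ^+ 2 * d2 + q2 ^+ 2 * d1 + qA ^+ 2) - q1 * q2 * qA)).
  by ring.
by rewrite M subrr mulr0.
Qed.

Lemma markov_word z W : markov z (word_edge W).
Proof.
elim/last_ind: W => [|W b IH].
  rewrite /markov -[apex _]/fhalf /= value_Q0 value_Q1 value_Qhalf !value_dE /=.
  by rewrite expr0 expr1 !expr1n !mul1r; ring.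
by rewrite word_edge_rcons; apply: markov_step (unimodular_word W) IH.
Qed.

(** The square of the normalized trace Q(f) / sqrt (d_Q(f)); the square is what
the shape parameters depend on, and it needs no choice of a root. *)
Definition trace2 z f : C := value_Q z f ^+ 2 / value_d z f.

(** Vieta's formula: by the Markov equation the traces at the two vertices opposite
to an edge are the roots of X^2 - q(e^L) q(e^R) X + q(e^L)^2 + q(e^R)^2. *)
Lemma trace2_flip z W b : z != 0 ->
  let e := word_edge W in let e' := edge_step e b in
  trace2 z (if b then e.2 else e.1) * trace2 z (apex e')
    = (trace2 z e'.1 + trace2 z e'.2) ^+ 2.
Proof.
move=> z0 e e'; have ue := unimodular_word W; have M := markov_word z W.
have ue' := unimodular_step b ue.
have dA := value_d_apex z ue; have := value_d_apex z ue'.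
have := value_Q_step z b ue.
have := value_d_neq0 e.1 z0; have := value_d_neq0 e.2 z0.
rewrite /trace2 /e'; move: M dA; rewrite /markov -/e.
case: b {ue' e'} => /=; set qA := value_Q z (apex e);
set q1 := value_Q z e.1; set q2 := value_Q z e.2;
set d1 := value_d z e.1; set d2 := value_d z e.2 => M dA n2 n1 -> ->; rewrite dA.
  have -> : q2 ^+ 2 / d2 * ((- d1 * q2 + q1 * qA) ^+ 2 / (d1 * (d1 * d2)))
     = (q1 * q2 * qA - d1 * q2 ^+ 2) ^+ 2 / (d1 * d2) ^+ 2 by field; rewrite n1 n2.
  by rewrite -M; field; rewrite n1 n2.
have -> : q1 ^+ 2 / d1 * ((- d2 * q1 + q2 * qA) ^+ 2 / (d1 * d2 * d2))
   = (q1 * q2 * qA - d2 * q1 ^+ 2) ^+ 2 / (d1 * d2) ^+ 2 by field; rewrite n1 n2.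
by rewrite -M; field; rewrite n1 n2.
Qed.

Lemma calZ_word z W : z != 0 -> (0 < size W)%N ->
  calZ Q (word_edge W) z = - (trace2 z (word_edge W).1 / trace2 z (word_edge W).2).
Proof.
case/lastP: W => // W b z0 _; rewrite word_edge_rcons.
have ue := unimodular_word W; have dA := value_d_apex z ue.
have := value_d_neq0 (word_edge W).1 z0; have := value_d_neq0 (word_edge W).2 z0.
have [_ _ Lb a0] := ue.
have b0 : 0 < (word_edge W).2.2 by lia.
move: dA a0 b0; set e := word_edge W => dA a0 b0 n2 n1.
rewrite /calZ /nu /ehat /eminus /eplus /trace2 -/(value_d z _) -/(value_Q z _) -/(value_Q z _).
have aE : (apex e).2 = e.1.2 + e.2.2 by [].
have a1 : apex e - e.1 = e.2 by rewrite /apex addrC addKr.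
have a2 : apex e - e.2 = e.1 by rewrite /apex addrK.
case: b; rewrite /edge_step; move: (apex e) dA aE a1 a2 => A dA aE a1 a2 /=.
  have -> : e.1.2 < A.2 by rewrite aE ltrDl.
  rewrite eqxx a1 /= dA opprK expr1z expr_div_n.
  set q1 := value_Q z e.1; set qA := value_Q z A.
  have [->|qn] := eqVneq qA 0; first by rewrite expr0n /= !(invr0, mulr0, mul0r, oppr0).
  by field; rewrite qn n1 n2.
have -> : (A.2 < e.2.2) = false by rewrite aE gtrDr ltNge ltW.
have -> : (e.2 == A) = false.
  apply/negbTE/eqP => /(congr1 snd)/esym/eqP.
  by rewrite aE -subr_eq0 addrK gt_eqF.
rewrite a2 exprN1 expr_div_n dA.
set q2 := value_Q z e.2; set qA := value_Q z A.
have [->|qn] := eqVneq q2 0; first by rewrite expr0n /= !(invr0, mulr0, mul0r, oppr0).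
by field; rewrite qn n1 n2.
Qed.

End Values.

(** * Reversal and uniqueness of folded chains *)

Section Chains.
Variable (K : fieldType).

(** The relations of a folded chain treat the vertex left behind and the vertex
added symmetrically. *)
Lemma folded_chain_rev N d (l r : nat -> K) (s : bool) :
  folded_chain N d l r ->
  folded_chain N (fun i => s (+) d (N - i.+1)%N)
    (fun i => if s then r (N - i)%N else l (N - i)%N)
    (fun i => if s then l (N - i)%N else r (N - i)%N).
Proof.
move=> [e0 eN keep flip]; split.
- by rewrite subn0; case: s; rewrite // addrC.
- by rewrite subnn; case: s; rewrite // addrC.
- move=> j jN; have e1 : (N - j.+1).+1 = (N - j)%N by rewrite -subSn ?subSS.
  have := keep (N - j.+1)%N; rewrite e1 leq_subr => /(_ isT).
  by case: s; case: (d _) => /= ->.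
move=> j jN; have e1 : (N - j.+2).+1 = (N - j.+1)%N by rewrite -subSn ?subSS.
have e2 : (N - j.+1).+1 = (N - j)%N by rewrite -subSn ?subSS // ltnW.
have := flip (N - j.+2)%N; rewrite e1 e2 leq_subr => /(_ isT) h.
case: s; rewrite ?addTb ?addFb ?if_neg; last by rewrite -h mulrC.
by rewrite [r _ + _]addrC -h mulrC.
Qed.

Variables (Q : slope -> {poly int}) (calQ : is_calQ Q).
Implicit Types (z : K).

Definition left_trace z W j : K := trace2 Q z (word_edge (take j W)).1.
Definition right_trace z W j : K := trace2 Q z (word_edge (take j W)).2.

Lemma trace2_0 z : trace2 Q z f0 = z^-1.
Proof. by rewrite /trace2 value_Q0 // value_dE /= expr1n mul1r expr0 mul1r expr1. Qed.

Lemma trace2_1 z : trace2 Q z f1 = - z^-1.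
Proof. by rewrite /trace2 value_Q1 // value_dE /= expr1n mul1r !expr1 mulN1r invrN. Qed.

Lemma trace2_half z : trace2 Q z fhalf = - z ^- 2.
Proof. by rewrite /trace2 value_Qhalf // value_dE /= expr1n mul1r expr1 mulN1r invrN. Qed.

Lemma tr_step z W j : (j < size W)%N ->
  let t := trace2 Q z (apex (word_edge (take j W))) in
  (left_trace z W j.+1, right_trace z W j.+1)
    = if nth false W j then (left_trace z W j, t) else (t, right_trace z W j).
Proof. by move=> jW; rewrite /left_trace /right_trace word_edge_take //; case: (nth _ _ _). Qed.

Lemma tr_flip z W j : z != 0 -> (j < size W)%N ->
  (if nth false W j then right_trace z W j else left_trace z W j)
    * trace2 Q z (apex (word_edge (take j.+1 W)))
  = (left_trace z W j.+1 + right_trace z W j.+1) ^+ 2.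
Proof.
move=> z0 jW; rewrite /left_trace /right_trace word_edge_take //.
rewrite -(trace2_flip calQ (take j W) (nth false W j) z0).
by case: (nth _ _ _).
Qed.

Lemma tr_markov z W : z != 0 ->
  let e := word_edge W in
  let t1 := trace2 Q z e.1 in let t2 := trace2 Q z e.2 in
  let t := trace2 Q z (apex e) in
  (t1 + t2 + t) ^+ 2 = t1 * t2 * t.
Proof.
move=> z0 e; have ue := unimodular_word W; have := markov_word calQ z W.
have := value_d_neq0 e.1 z0; have := value_d_neq0 e.2 z0.
rewrite /trace2 (value_d_apex z ue) /markov -/e.
set q1 := value_Q _ _ _; set q2 := value_Q _ _ _; set q := value_Q _ _ _.
set d1 := value_d _ _; set d2 := value_d _ _ => n2 n1 M.
transitivity ((q1 * q2 * q / (d1 * d2)) ^+ 2); last by field; rewrite n1 n2.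
by rewrite -M; field; rewrite n1 n2.
Qed.

(** The last folding condition is where the root enters: as Q vanishes at alpha,
the relation at the last edge makes the square of the sum vanish. *)
Lemma folded_chain_values z W : z != 0 -> (0 < size W)%N ->
  trace2 Q z (apex (word_edge W)) = 0 ->
  folded_chain (size W) (nth false W) (left_trace z W) (right_trace z W).
Proof.
move=> z0 W0 root; split.
- by rewrite /left_trace /right_trace take0 /= trace2_0 trace2_1 subrr.
- have := @tr_flip z W (size W).-1 z0; rewrite prednK // take_size root mulr0.
  by move/(_ (leqnn _))/esym/eqP; rewrite expf_eq0 => /eqP.
- by move=> j jW; have := tr_step z jW; case: (nth _ _ _) => -[e1 e2].
move=> j jW; rewrite -tr_flip // ?(ltnW jW) //; congr (_ * _).
by have := tr_step z jW; case: (nth _ _ j.+1) => -[e1 e2].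
Qed.

(** The relation at each edge determines the value at the next mediant.  At the last
edge, where the folding condition makes the right-hand side vanish, it forces
the value at the final mediant to be 0. *)
Lemma folded_chain_unique z W (l r : nat -> K) : z != 0 -> head false W ->
  folded_chain (size W) (nth false W) l r ->
  (forall j, (j <= size W)%N -> l j != 0 /\ r j != 0) ->
  l 0%N = z^-1 -> r 1%N = - z ^- 2 ->
  trace2 Q z (apex (word_edge W)) = 0 /\
  forall j, (j <= size W)%N -> left_trace z W j = l j /\ right_trace z W j = r j.
Proof.
move=> z0 hW [e0 eN keep flip] nz l0 r1.
have W0 : (0 < size W)%N by case: W hW {eN keep flip nz}.
have claim j : (j <= size W)%N -> (left_trace z W j = l j /\ right_trace z W j = r j) /\
    ((j < size W)%N -> trace2 Q z (apex (word_edge (take j W)))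
       = if nth false W j then r j.+1 else l j.+1).
  elim: j => [_|j IH jW].
    rewrite /left_trace /right_trace take0 /= trace2_0 trace2_1; split; last first.
      by move=> _; rewrite nth0 hW r1 -trace2_half.
    by split; rewrite // -l0; apply/eqP; rewrite eq_sym -addr_eq0 addrC e0.
  have [[el er] /(_ jW) et] := IH (ltnW jW).
  have pr : left_trace z W j.+1 = l j.+1 /\ right_trace z W j.+1 = r j.+1.
    have := tr_step z jW; have := keep _ jW; rewrite /= et.
    by case: (nth _ _ j) => -> -[-> ->].
  split=> // jW'; have := tr_flip z0 jW; case: pr => -> ->.
  rewrite -flip // el er; have [ln rn] := nz j (ltnW jW).
  by apply: mulfI; case: (nth _ _ j).
split; last by move=> j /claim[].
have := @tr_flip z W (size W).-1 z0; rewrite prednK // take_size => /(_ (leqnn _)).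
have [[-> ->] _] := claim _ (leqnn (size W)); rewrite eN expr0n /= => /eqP.
have [[-> ->] _] := claim _ (leq_pred (size W)).
have [ln rn] := nz _ (leq_pred (size W)).
by rewrite mulf_eq0 => /orP[|/eqP //]; case: (nth _ _ _); [move: rn|move: ln] => /negbTE ->.
Qed.

End Chains.

(** * Geometric roots and their reversal *)

Section Geometric.
Variables (R : realType) (Q : slope -> {poly int}) (calQ : is_calQ Q).
Implicit Types (z : R[i]) (W : seq bool).

Definition geometric W z : Prop :=
  [/\ 0 < 'Im z, peval (Q (apex (word_edge W))) z = 0
    & forall j, (0 < j < size W)%N ->
        0 < 'Im (calZ Q (word_edge (take j W)) z)].

Lemma geometricE W alpha z : (0 < size W)%N ->
  alpha = rat_of (apex (word_edge W)) ->
  geometric W z <->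
  [/\ 0 < 'Im z, peval (Q (frac_of alpha)) z = 0
    & forall j : nat, (1 <= j <= interior alpha)%N ->
        0 < 'Im (calZ Q (funnel alpha j) z)].
Proof.
move=> W0 alphaE; rewrite (frac_of_word alphaE) (interior_word alphaE).
have jE j : (j <= (size W).-1)%N = (j < size W)%N by rewrite -[in RHS](prednK W0).
split=> -[z0 root up]; split=> // j /andP[j0 jW].
  by rewrite (funnel_word alphaE) ?up ?j0 // -?jE // (leq_trans jW) // leq_pred.
by rewrite -(funnel_word alphaE) ?up ?j0 ?jE // ltnW.
Qed.

Section OneRoot.
Variables (W : seq bool) (z : R[i]).
Hypotheses (hW : head false W) (geo : geometric W z).
Let N := size W.
Let l := left_trace Q z W.
Let r := right_trace Q z W.

Let z0 : z != 0. Proof. by case: geo => /upper_neq0. Qed.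
Let W0 : (0 < N)%N. Proof. by rewrite /N; case: W hW. Qed.

Lemma geometric_root_trace : trace2 Q z (apex (word_edge W)) = 0.
Proof. by case: geo => _ e _; rewrite /trace2 /value_Q e expr0n mul0r. Qed.

Lemma geometric_calZ j : (0 < j <= N)%N ->
  calZ Q (word_edge (take j W)) z = - (l j / r j).
Proof.
move=> /andP[j0 jN]; rewrite calZ_word // size_take; case: ifP => // _; exact: W0.
Qed.

Lemma geometric_upper j : (0 < j < N)%N -> 0 < 'Im (- (l j / r j)).
Proof.
move=> /andP[j0 jN]; rewrite -geometric_calZ ?j0 1?ltnW //.
by case: geo => _ _ -> //; rewrite j0.
Qed.

Lemma geometric_start : [/\ l 0%N = z^-1, r 0%N = - z^-1, l 1%N = z^-1
  & r 1%N = - z ^- 2].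
Proof.
have l0 : left_trace Q z W 0 = z^-1 by rewrite /left_trace take0 trace2_0.
have r0 : right_trace Q z W 0 = - z^-1 by rewrite /right_trace take0 trace2_1.
have := tr_step Q z W0; rewrite take0 nth0 hW l0.
by rewrite -[apex _]/fhalf trace2_half // => -[l1 r1]; split.
Qed.

(** An interior edge has nonzero values because its shape parameter is not real;
as this parameter is not 1 either, the value at the next mediant is nonzero. *)
Lemma geometric_neq0 j : (j <= N)%N -> l j != 0 /\ r j != 0.
Proof.
have [l0 r0 _ _] := geometric_start.
elim: j => [_|j IH jN]; first by rewrite l0 r0 oppr_eq0 invr_eq0.
have [ln rn] := IH (ltnW jN).
suff tn : trace2 Q z (apex (word_edge (take j W))) != 0.
  by have := tr_step Q z jN; rewrite -/l -/r; case: (nth _ _ _) => -[-> ->].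
case: j jN ln rn {IH} => [|j] jN ln rn.
  by rewrite take0 -[apex _]/fhalf trace2_half // oppr_eq0 invr_eq0 expf_neq0.
have := tr_flip calQ z0 (ltnW jN); rewrite -/l -/r => e.
have : (l j.+1 + r j.+1) ^+ 2 != 0.
  have /upper_neq1 := geometric_upper (j := j.+1) jN.
  rewrite opprK -{1}(divff rn) -mulrDl mulf_eq0 invr_eq0 (negbTE rn) orbF addrC.
  exact: expf_neq0.
by rewrite -e mulf_eq0 negb_or => /andP[].
Qed.

Lemma geometric_chain : folded_chain N (nth false W) l r.
Proof. exact: folded_chain_values geometric_root_trace. Qed.

(** As the word has n + 1 letters, the bound is strict if n >= 2. *)
Lemma geometric_norm : false \in W -> `|z| < 1 ?<= if (N <= 2)%N.
Proof.
move=> /(nthP false)[i iN di].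
have [l0 r0 _ r1] := geometric_start.
apply: (angle_bound geometric_chain _ l0 r1 geometric_neq0 _ geometric_upper).
- by rewrite nth0.
- by case: geo.
by exists i; rewrite ?di.
Qed.

(** The value at the vertex opposite to the last edge follows from the Markov
equation.  Read backwards it is the normalization of the first values at a
root, those at 0, 1 and 1/2. *)
Lemma geometric_end (s := ends_right W) :
  (if s then l N.-1 else r N.-1) = - (if s then r N else l N) ^+ 2.
Proof.
have [_ eN keep _] := geometric_chain.
set t := trace2 Q z (apex (word_edge (take N.-1 W))).
have M : (l N.-1 + r N.-1 + t) ^+ 2 = l N.-1 * r N.-1 * t.
  exact: (tr_markov calQ (take N.-1 W) z0).
have step : (l N, r N) = if nth false W N.-1 then (l N.-1, t) else (t, r N.-1).
  have := @tr_step _ Q z W N.-1; rewrite (prednK W0) => h.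
  exact: h (leqnn _).
have [ln rn] := geometric_neq0 (leq_pred N).
have ds : nth false W N.-1 = ~~ s.
  by rewrite /s /ends_right negbK nth_last; case: W hW.
move: step; rewrite ds; case: s {ds} => /= -[e1 e2].
  have : l N.-1 * (l N.-1 + r N ^+ 2) = 0.
    have et : t = - r N by apply/eqP; rewrite -e1 -addr_eq0 eN.
    move: M; rewrite et -e2 => M.
    have -> : l N.-1 * (l N.-1 + r N ^+ 2)
       = (l N.-1 + r N + - r N) ^+ 2 - l N.-1 * r N * - r N by ring.
    by rewrite M subrr.
  by move/eqP; rewrite mulf_eq0 (negbTE ln) addr_eq0 => /eqP.
have : r N.-1 * (r N.-1 + l N ^+ 2) = 0.
  have et : t = - l N by apply/eqP; rewrite -e2 -addr_eq0 addrC eN.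
  move: M; rewrite et -e1 => M.
  have -> : r N.-1 * (r N.-1 + l N ^+ 2)
     = (l N + r N.-1 + - l N) ^+ 2 - l N * r N.-1 * - l N by ring.
  by rewrite M subrr.
by move/eqP; rewrite mulf_eq0 (negbTE rn) addr_eq0 => /eqP.
Qed.

End OneRoot.

Lemma value_conj z f : value_Q Q z^* f = (value_Q Q z f)^* /\
  value_d z^* f = (value_d z f)^*.
Proof.
have pc (p : {poly int}) : peval p z^* = (peval p z)^*.
  rewrite /peval -horner_map -map_poly_comp; congr (_.[_]).
  by apply: eq_map_poly => x /=; rewrite rmorph_int.
by rewrite /value_Q /value_d !pc.
Qed.

Lemma trace2_conj z f : trace2 Q z^* f = (trace2 Q z f)^*.
Proof.
by rewrite /trace2; have [-> ->] := value_conj z f; rewrite rmorphM fmorphV rmorphXn.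
Qed.

Lemma calZ_conj z W : z != 0 -> (0 < size W)%N ->
  calZ Q (word_edge W) z^* = (calZ Q (word_edge W) z)^*.
Proof.
move=> z0 W0; rewrite !calZ_word ?conjC_eq0 // !trace2_conj.
by move: (trace2 _ _ _) (trace2 _ _ _) => a b; rewrite rmorphN rmorphM fmorphV.
Qed.

Lemma trace2_eq0 z f : z != 0 -> trace2 Q z f = 0 -> value_Q Q z f = 0.
Proof.
move=> z0 /eqP; rewrite /trace2 mulf_eq0 invr_eq0 (negbTE (value_d_neq0 _ z0)).
by rewrite orbF expf_eq0 => /eqP.
Qed.

(** The last clause makes the construction an involution.  The root w0 of the
reversed chain is the inverse of its first value; without exchange of left and
right it is zn itself, with exchange it lies in the lower half-plane and is
replaced by its conjugate. *)
Lemma geometric_rev W z : head false W -> (1 < size W)%N -> geometric W z ->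
  let zn := calZ Q (word_edge (take (size W).-1 W)) z in
  let w := if ends_right W then (zn^*)^-1 else zn in
  geometric (rev_word W) w /\
  calZ Q (word_edge (take (size W).-1 (rev_word W))) w
    = if ends_right W then (z^*)^-1 else z.
Proof.
move=> hW W1 geo zn w.
have W0 := ltnW W1; have z0 : z != 0 by case: geo => /upper_neq0.
have nz := geometric_neq0 hW geo; have chain := geometric_chain hW geo.
have [sl0 _ sl1 sr1] := geometric_start z hW.
have W2 : (0 < (size W).-1 < size W)%N by rewrite -ltnS !prednK // W1 /=.
have znE : zn = - (left_trace Q z W (size W).-1 / right_trace Q z W (size W).-1).
  by apply: geometric_calZ => //; case/andP: W2 => -> /ltnW.
have zn_up : 0 < 'Im zn by rewrite znE; apply: geometric_upper.
have gend := geometric_end hW geo.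
set s := ends_right W in w gend *.
have dN : nth false W (size W).-1 = ~~ s.
  by rewrite /s /ends_right negbK nth_last; case: (W) hW.
set l := left_trace Q z W in nz chain znE gend sl0 sl1; set r := right_trace Q z W in nz chain znE gend sr1.
pose l' i := if s then r (size W - i)%N else l (size W - i)%N.
pose r' i := if s then l (size W - i)%N else r (size W - i)%N.
pose w0 := (l' 0%N)^-1.
have [lN rN] := nz _ (leqnn (size W)).
have l'0 : l' 0%N != 0 by rewrite /l' subn0; case: (s).
have w0n : w0 != 0 by rewrite invr_eq0.
have chain' : folded_chain (size (rev_word W)) (nth false (rev_word W)) l' r'.
  rewrite size_rev_word; have [c1 c2 c3 c4] := folded_chain_rev s chain.
  split; [exact: c1|exact: c2| |] => j jW.
    by rewrite (nth_rev_word jW); apply: c3 jW.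
  by rewrite (nth_rev_word jW) (nth_rev_word (ltnW jW)); apply: c4 jW.
have nz' j : (j <= size (rev_word W))%N -> l' j != 0 /\ r' j != 0.
  move=> _; have [ln rn] := nz _ (leq_subr j (size W)).
  by rewrite /l' /r'; case: (s).
have r'1 : r' 1%N = - w0 ^- 2.
  by rewrite /w0 /r' /l' subn0 subn1 exprVn invrK; move: gend; case: (s).
have [root vals] := folded_chain_unique calQ w0n (head_rev_word W0) chain' nz' (esym (invrK _)) r'1.
have calZ0 j : (0 < j <= size W)%N ->
    calZ Q (word_edge (take j (rev_word W))) w0 = - (l' j / r' j).
  move=> /andP[j0 jN]; rewrite calZ_word // -?/(left_trace Q w0 _ j) -?/(right_trace Q w0 _ j).
    by have [|-> ->] := vals j; rewrite ?size_rev_word.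
  by rewrite size_take size_rev_word; case: ifP.
have wE : w = if s then w0^* else w0.
  have [_ _ keep _] := chain.
  have := keep (size W).-1; rewrite dN prednK // leqnn => /(_ isT).
  rewrite /w znE /w0 /l' subn0; move: gend; case: (s) => /= -> e.
    by rewrite -e -fmorphV; congr (_^*); field; rewrite rN.
  by rewrite -e; field; rewrite lN.
have w0_up : 0 < 'Im (if s then w0^* else w0).
  rewrite -wE /w; case: (s) => //.
  by rewrite -fmorphV Im_conj oppr_gt0; apply: ImV_lt0.
have calZw j : (0 < j <= size W)%N ->
    calZ Q (word_edge (take j (rev_word W))) w
      = if s then (- (l' j / r' j))^* else - (l' j / r' j).
  move=> jb; rewrite wE -(calZ0 j jb); case/andP: jb => j0 jN.
  have sz : (0 < size (take j (rev_word W)))%N.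
    by rewrite size_take size_rev_word; case: ifP.
  by case: (s) => //; rewrite calZ_conj.
split; first split.
- by rewrite wE.
- rewrite wE; have := trace2_eq0 w0n root => e.
  case: (s) => //; have [] := value_conj w0 (apex (word_edge (rev_word W))).
  by rewrite e rmorph0.
- rewrite size_rev_word => j /andP[j0 jW].
  have jb : (0 < j <= size W)%N by rewrite j0 ltnW.
  rewrite (calZw j jb).
  have jW' : (0 < size W - j < size W)%N by rewrite subn_gt0 jW ltn_subrL j0.
  have up := geometric_upper hW geo jW'; rewrite -/l -/r in up.
  rewrite /l' /r'; case: (s) => //.
  rewrite Im_conj oppr_gt0.
  have -> : - (r (size W - j)%N / l (size W - j)%N) = (- (l (size W - j)%N / r (size W - j)%N))^-1.
    by rewrite invrN invf_div.
  exact: ImV_lt0.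
rewrite (calZw _ (_ : (0 < (size W).-1 <= size W)%N)); last by case/andP: W2 => -> /ltnW.
have e1 : (size W - (size W).-1 = 1)%N by rewrite -subn1 subKn.
rewrite /l' /r' e1 sl1 sr1; case: (s).
  by rewrite -fmorphV; congr (_^*); field.
by field.
Qed.

End Geometric.

(** * The interior of a tetrahedron in the quotient *)

Section Lattice.

Definition lattice_point (e : edge) (P : gauss) (a b : int) : gauss :=
  P + dir e.1 *~ a + dir e.2 *~ b.

Lemma pair_mulrz (x y a : int) : ((x, y) : gauss) *~ a = (x * a, y * a).
Proof.
by rewrite [LHS]surjective_pairing (raddfMz fst) (raddfMz snd) /= !mulrzz.
Qed.

Lemma dir_free e a b : unimodular e ->
  dir e.1 *~ a + dir e.2 *~ b = 0 -> a = 0 /\ b = 0.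
Proof.
case: e => [[a1 a2] [b1 b2]] [/= det _ _ _].
rewrite /dir /= !pair_mulrz => -[h1 h2].
have ha : a = (b1 * a2 - a1 * b2) * a by rewrite det mul1r.
have hb : b = (b1 * a2 - a1 * b2) * b by rewrite det mul1r.
split; [rewrite ha|rewrite hb].
  transitivity (b1 * (a2 * a + b2 * b) - b2 * (a1 * a + b1 * b)); first by ring.
  by rewrite h1 h2 !mulr0 subrr.
transitivity (a2 * (a1 * a + b1 * b) - a1 * (a2 * a + b2 * b)); first by ring.
by rewrite h1 h2 !mulr0 subrr.
Qed.

Lemma lattice_point_inj e P a b a' b' : unimodular e ->
  lattice_point e P a b = lattice_point e P a' b' -> a = a' /\ b = b'.
Proof.
move=> ue /eqP; rewrite /lattice_point -!addrA (inj_eq (addrI P)) -subr_eq0.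
rewrite opprD addrACA -!mulrzBr => /eqP /(dir_free ue) [/eqP + /eqP].
by rewrite !subr_eq0 => /eqP -> /eqP ->.
Qed.

Lemma lattice_pointB e P a b a' b' :
  lattice_point e P a b - lattice_point e P a' b'
    = dir e.1 *~ (a - a') + dir e.2 *~ (b - b').
Proof.
rewrite /lattice_point !mulrzBr opprD addrACA; congr (_ + _).
by rewrite opprD addrACA subrr add0r.
Qed.

Lemma dir_lattice e : dir e.1 = lattice_point e 0 1 0 /\ dir e.2 = lattice_point e 0 0 1.
Proof. by rewrite /lattice_point !mulr0z !mulr1z !add0r addr0. Qed.

Lemma joins_lattice e P a b a' b' : unimodular e ->
  joins e.1 (lattice_point e P a b) (lattice_point e P a' b')
    = ((a' - a == 1) || (a - a' == 1)) && (b == b') /\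
  joins e.2 (lattice_point e P a b) (lattice_point e P a' b')
    = ((b' - b == 1) || (b - b' == 1)) && (a == a').
Proof.
move=> ue.
have eqE x y x' y' : (dir e.1 *~ x + dir e.2 *~ y == dir e.1 *~ x' + dir e.2 *~ y')
    = (x == x') && (y == y').
  apply/eqP/andP => [h|[/eqP -> /eqP ->] //].
  have := @lattice_point_inj e 0 x y x' y' ue.
  by rewrite /lattice_point !add0r => /(_ h) [-> ->]; rewrite !eqxx.
have eq1 x y : (dir e.1 *~ x + dir e.2 *~ y == dir e.1) = (x == 1) && (y == 0).
  by rewrite -eqE mulr1z mulr0z addr0.
have eq2 x y : (dir e.1 *~ x + dir e.2 *~ y == dir e.2) = (x == 0) && (y == 1).
  by rewrite -eqE mulr1z mulr0z add0r.
have sub0 (x y : int) : (y - x == 0) = (x == y) by rewrite subr_eq0 eq_sym.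
rewrite /joins !lattice_pointB 2!eq1 2!eq2 4!sub0 (eq_sym b' b) (eq_sym a' a).
by rewrite !andb_orl ![(a == a') && _]andbC.
Qed.

Lemma tet_verticesE alpha j P :
  let e := funnel alpha j in
  tet_vertices alpha j P = [:: lattice_point e P 0 0; lattice_point e P 1 0;
    lattice_point e P 0 1; lattice_point e P 1 1].
Proof. by rewrite /tet_vertices /lattice_point !mulr0z !mulr1z !addr0. Qed.

Lemma tet_vertices_diff alpha j P x y :
  x \in tet_vertices alpha j P -> y \in tet_vertices alpha j P ->
  exists a b : int, [/\ x - y = dir (funnel alpha j).1 *~ a + dir (funnel alpha j).2 *~ b,
    -1 <= a <= 1 & -1 <= b <= 1].
Proof.
rewrite tet_verticesE !inE.
have key a b a' b' : x = lattice_point (funnel alpha j) P a b -> y = lattice_point (funnel alpha j) P a' b' ->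
   0 <= a <= 1 -> 0 <= b <= 1 -> 0 <= a' <= 1 -> 0 <= b' <= 1 ->
   exists a b : int, [/\ x - y = dir (funnel alpha j).1 *~ a + dir (funnel alpha j).2 *~ b,
    -1 <= a <= 1 & -1 <= b <= 1].
  by move=> -> -> *; exists (a - a'), (b - b'); rewrite lattice_pointB; split=> //; lia.
by do ![case/orP] => /eqP ex; do ![case/orP] => /eqP ey; apply: (key _ _ _ _ ex ey).
Qed.

Lemma uniq_tet_vertices alpha j P : unimodular (funnel alpha j) ->
  uniq (tet_vertices alpha j P).
Proof.
move=> ue; rewrite tet_verticesE /= !inE.
have neq a b a' b' : (a != a') || (b != b') ->
    (lattice_point (funnel alpha j) P a b == lattice_point (funnel alpha j) P a' b') = false.
  by move=> ne; apply/negbTE; apply: contraTN ne => /eqP /(lattice_point_inj ue) [-> ->]; rewrite !eqxx.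
by rewrite !neq.
Qed.

(** Rotations and translations.  All translations are admitted, although Theta
contains only those by even vectors, because labels are invariant under all. *)
Definition flip_shift (n : bool) (c x : gauss) : gauss := (if n then - x else x) + c.

Lemma flip_shiftB n c x y :
  flip_shift n c x - flip_shift n c y = if n then y - x else x - y.
Proof.
rewrite /flip_shift opprD addrACA subrr addr0; case: n => //.
by rewrite opprK addrC.
Qed.

Lemma flip_shift_inj n c : injective (flip_shift n c).
Proof. by move=> x y /addIr; case: n => // /oppr_inj. Qed.

Lemma joins_flip_shift f n c a b :
  joins f (flip_shift n c a) (flip_shift n c b) = joins f a b.
Proof. by rewrite /joins !flip_shiftB; case: n => //; rewrite orbC. Qed.

End Lattice.

Section Weights.
Variable R : realType.
Implicit Types (l : seq (gauss * R)).

Lemma weight_mem l x : weight l x != 0 -> x \in map fst l.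
Proof.
apply: contraNT => nx; rewrite /weight big_seq_cond big1 // => p /andP[pl /eqP px].
by case/negP: nx; rewrite -px map_f.
Qed.

Lemma weight_relocate (h : gauss -> gauss) l x : injective h ->
  weight (relocate h l) (h x) = weight l x.
Proof.
move=> hi; rewrite /weight /relocate big_map /=.
by apply: eq_bigl => p; rewrite (inj_eq hi).
Qed.

Lemma weight_cons p l x :
  weight (p :: l) x = (if p.1 == x then p.2 else 0) + weight l x.
Proof. by rewrite /weight big_cons; case: ifP; rewrite ?add0r. Qed.

Lemma weight_zip (s : seq gauss) (t : seq R) k : uniq s -> size s = size t ->
  (k < size s)%N -> weight (zip s t) (nth 0 s k) = nth 0 t k.
Proof.
elim: s t k => [|x s IH] [|y t] //= k /andP[xs us] [st].
have w0 : weight (zip s t) x = 0.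
  apply/eqP; apply: contraNT xs => /weight_mem.
  by rewrite -/unzip1 unzip1_zip ?st.
case: k => [_|k ks]; rewrite weight_cons /=; first by rewrite eqxx w0 addr0.
rewrite IH //; case: eqP => [e|_]; last by rewrite add0r.
by rewrite e mem_nth in xs.
Qed.

End Weights.

Section Invariant.
Variables (R : realType) (alpha : rat) (W : seq bool).
Hypotheses (W1 : (1 < size W)%N) (alphaE : alpha = rat_of (apex (word_edge W))).
Variables (j0 : nat) (P0 : gauss) (l0 : seq (gauss * R)).
Hypothesis j0_layer : (1 <= j0 <= interior alpha)%N.
Hypothesis l0_pos : forall x, x \in tet_vertices alpha j0 P0 -> weight l0 x != 0.

(** The invariant of the gluing relation that recognizes an interior point l0 of a
tetrahedron of layer j0. *)
Definition is_copy (m : point R) : Prop :=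
  m.1 = j0 /\ exists n c, forall x, weight m.2 (flip_shift n c x) = weight l0 x.

Let funnelE j : (1 <= j <= interior alpha)%N -> funnel alpha j = word_edge (take j W).
Proof.
rewrite (interior_word alphaE) => /andP[_ jW].
by apply: (funnel_word alphaE); apply: leq_trans jW (leq_pred _).
Qed.

Let funnelS j : (j.+1 <= interior alpha)%N ->
  exists b, unimodular (funnel alpha j) /\ funnel alpha j.+1 = edge_step (funnel alpha j) b.
Proof.
rewrite (interior_word alphaE) => jW.
have jW' : (j < size W)%N := leq_trans jW (leq_pred _).
exists (nth false W j); rewrite !(funnel_word alphaE) // 1?ltnW //.
by split; [apply: unimodular_word | apply: word_edge_take].
Qed.

Lemma copy_in_tet l n c P j :
  (forall x, weight l (flip_shift n c x) = weight l0 x) ->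
  (forall p, p \in l -> p.1 \in tet_vertices alpha j P /\ 0 <= p.2) ->
  forall x, x \in tet_vertices alpha j0 P0 -> flip_shift n c x \in tet_vertices alpha j P.
Proof.
move=> wl lP x /l0_pos; rewrite -wl => /weight_mem /mapP[p pl ->].
by have [] := lP p pl.
Qed.

(** A point with positive weight at all four vertices of a tetrahedron is not on its
boundary, so it does not lie in an adjacent layer: for the edge e of a layer and the
edge e' of the next one, e^R - e^L is not a difference of two vertices of a
tetrahedron of the next layer, nor is the sum of the ends of e' one for the first. *)
Lemma copy_not_stacked j l n c :
  M_points alpha (j, l) -> M_points alpha (j.+1, l) -> j = j0 \/ j.+1 = j0 ->
  ~ (forall x, weight l (flip_shift n c x) = weight l0 x).
Proof.
case=> [/= jb [P lP] _ _]; case=> [/= jS [P' lP'] _ _] hj wl.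
have [b [ue e2]] := funnelS jS.
have dapex : dir (apex (funnel alpha j)) = dir (funnel alpha j).1 + dir (funnel alpha j).2 by [].
set u := dir (funnel alpha j).1 in dapex *; set v := dir (funnel alpha j).2 in dapex *.
have free x y x' y' : u *~ x + v *~ y = u *~ x' + v *~ y' -> x = x' /\ y = y'.
  have := @lattice_point_inj (funnel alpha j) 0 x y x' y' ue.
  by rewrite /lattice_point !add0r.
have [sg [sg2 fsB]] : exists sg : int, (sg = 1 \/ sg = -1) /\
    forall x y, flip_shift n c x - flip_shift n c y = (x - y) *~ sg.
  case: (n); [exists (-1)|exists 1]; split; try by [left|right].
    by move=> x y; rewrite flip_shiftB mulrNz mulr1z opprB.
  by move=> x y; rewrite flip_shiftB mulr1z.
case: hj => hj.
  have xin : P0 + u \in tet_vertices alpha j0 P0.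
    by rewrite -hj /tet_vertices !inE eqxx orbT.
  have yin : P0 + v \in tet_vertices alpha j0 P0.
    by rewrite -hj /tet_vertices !inE eqxx !orbT.
  have [a [a' [+ ab ab']]] :=
    tet_vertices_diff (copy_in_tet wl lP' xin) (copy_in_tet wl lP' yin).
  rewrite fsB opprD addrACA subrr add0r e2 /edge_step mulrzBl -mulrNz.
  case: b {e2} => /=; rewrite dapex mulrzDl.
    by rewrite addrA -mulrzDr => /free; lia.
  by rewrite -addrA -mulrzDr => /free; lia.
have xin : P0 + dir (funnel alpha j.+1).1 + dir (funnel alpha j.+1).2 \in tet_vertices alpha j0 P0.
  by rewrite -hj /tet_vertices !inE eqxx !orbT.
have yin : P0 \in tet_vertices alpha j0 P0.
  by rewrite -hj /tet_vertices !inE eqxx.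
have [a [a' [+ ab ab']]] :=
  tet_vertices_diff (copy_in_tet wl lP xin) (copy_in_tet wl lP yin).
rewrite fsB -(addrA P0) addrAC subrr add0r e2 /edge_step -/u -/v.
case: b {e2 xin} => /=; rewrite dapex -/u -/v !mulrzDl.
  by rewrite addrA -mulrzDr => /free; lia.
by rewrite -addrA -mulrzDr => /free; lia.
Qed.

(** Foldings only concern points of triangles, with at most three positive weights. *)
Lemma copy_not_triangle l n c : (size l <= 3)%N ->
  ~ (forall x, weight l (flip_shift n c x) = weight l0 x).
Proof.
move=> sl wl.
have us : uniq (tet_vertices alpha j0 P0).
  by apply: uniq_tet_vertices; rewrite funnelE //; apply: unimodular_word.
have : (size (map (flip_shift n c) (tet_vertices alpha j0 P0)) <= size (map fst l))%N.
  apply: uniq_leq_size; first by rewrite map_inj_uniq //; apply: flip_shift_inj.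
  by move=> _ /mapP[x /l0_pos + ->]; rewrite -wl => /weight_mem.
by rewrite !size_map /=; move: sl; lia.
Qed.

Lemma glued_copy m m' : M_points alpha m -> M_points alpha m' ->
  glued alpha m m' -> is_copy m <-> is_copy m'.
Proof.
move=> Mm Mm' g; case: g Mm Mm' => {m m'}.
- move=> j l l' ll _ _; split=> -[/= -> [n [c h]]]; split=> //; exists n, c => x.
    by rewrite -ll.
  by rewrite ll.
- move=> j l Mj Mj'; split=> -[/= hj [n [c h]]].
    by case: (@copy_not_stacked j l n c Mj Mj' (or_introl hj) h).
  by case: (@copy_not_stacked j l n c Mj Mj' (or_intror hj) h).
- move=> j a l _ _.
  have fE x : a *+ 2 - x = flip_shift true (a *+ 2) x by rewrite /flip_shift addrC.
  have comp n c x : flip_shift true (a *+ 2) (flip_shift n c x)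
      = flip_shift (~~ n) (a *+ 2 - c) x.
    by rewrite /flip_shift opprD; case: n => /=; rewrite ?opprK -addrA [in LHS](addrC (- c)).
  have inj : injective (fun x : gauss => a *+ 2 - x).
    by move=> x y; rewrite !fE; apply: flip_shift_inj.
  split=> -[/= hj [n [c h]]]; split=> //; exists (~~ n), (a *+ 2 - c) => x.
    by rewrite -comp -fE weight_relocate.
  by rewrite -comp -fE -(weight_relocate _ _ inj) subKr.
- move=> a b c ta tb tc _ _ _ _.
  by split=> -[_ [n [d h]]]; case: (@copy_not_triangle _ n d _ h).
move=> a b c ta tb tc _ _ _ _.
by split=> -[_ [n [d h]]]; case: (@copy_not_triangle _ n d _ h).
Qed.

(** The gluings along triangles do not reach interior points of tetrahedra, which
are therefore moved by rotations only. *)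
Lemma M_eq_copy m m' : M_eq alpha m m' -> is_copy m -> is_copy m'.
Proof.
move=> h; suff [] : is_copy m <-> is_copy m' by [].
elim: h => {m m'}.
- by move=> m m' [Mm Mm' g]; apply: glued_copy.
- by [].
- by move=> m m' _ [h1 h2]; split.
by move=> m1 m2 m3 _ [h1 h2] _ [h3 h4]; split=> h; [apply/h3/h1|apply/h2/h4].
Qed.

End Invariant.

(** * The orientation character of phi *)

Section Orientation.
Variables (R : realType) (W : seq bool) (alpha alphabar : rat).
Hypotheses (W1 : (1 < size W)%N) (alphaE : alpha = rat_of (apex (word_edge W)))
  (alphabarE : alphabar = rat_of (apex (word_edge (rev_word W)))).
Let s := ends_right W.
Let phiL := phi_linear alpha.

Lemma phi_linearB x y : phiL (x - y) = phiL x - phiL y.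
Proof. by rewrite /phiL phi_linearD phi_linearN. Qed.

(** Every vector is an integral combination of the ends of the last edge, whose
images are the directions of 0 and 1 up to sign. *)
Lemma phi_linear_inj : injective phiL.
Proof.
suff ker x : phiL x = 0 -> x = 0.
  move=> x y /eqP; rewrite -subr_eq0 -phi_linearB => /eqP /ker /eqP.
  by rewrite subr_eq0 => /eqP.
have W0 := ltnW W1.
have [h1 h2] := phi_last_edge W0 alphaE.
have := unimodular_word W; move: h1 h2; case: (word_edge W) => [[a1 a2] [b1 b2]] /= h1 h2 [/= det _ _ _].
pose a := b1 * x.1 - b2 * x.2; pose b := a2 * x.2 - a1 * x.1.
have xE : x = (a2, a1) *~ a + (b2, b1) *~ b.
  rewrite !pair_mulrz [LHS]surjective_pairing /a /b; congr pair => /=.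
    by rewrite -[LHS]mul1r -det; ring.
  by rewrite -[LHS]mul1r -det; ring.
have phiM y (k : int) : phiL (y *~ k) = phiL y *~ k.
  by case: y => y1 y2; rewrite /phiL /phi_linear !pair_mulrz /=; congr pair; ring.
rewrite xE /phiL phi_linearD -/phiL !phiM.
rewrite /dir /= in h1 h2; rewrite /phiL h1 h2 mulNrz.
move: (a) (b) => a' b'; rewrite !pair_mulrz => -[].
case: (ends_right W); rewrite /swap_sides /f0 /f1 /= => e1 e2.
  have [-> ->] : a' = 0 /\ b' = 0 by lia.
  by rewrite !mulr0.
have [-> ->] : a' = 0 /\ b' = 0 by lia.
by rewrite !mulr0.
Qed.

Let funnelE j : (1 <= j <= interior alpha)%N ->
  (j < size W)%N /\ funnel alpha j = word_edge (take j W).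
Proof.
rewrite (interior_word alphaE) => /andP[_ jW].
have jW' : (j < size W)%N by move: jW W1; case: (size W).
by split=> //; apply: (funnel_word alphaE); apply: ltnW.
Qed.

Let interiorE : interior alphabar = interior alpha.
Proof. by rewrite (interior_word alphabarE) (interior_word alphaE) size_rev_word. Qed.

Let reflected j := ((interior alpha).+1 - j)%N.

Let reflected_layer j : (1 <= j <= interior alpha)%N ->
  (1 <= reflected j <= interior alphabar)%N.
Proof. by rewrite interiorE /reflected; lia. Qed.

Lemma phi_funnel j : (1 <= j <= interior alpha)%N ->
  let e := funnel alpha j in
  let e' := swap_sides s (funnel alphabar (reflected j)) in
  [/\ unimodular e, unimodular (funnel alphabar (reflected j)),
     phiL (dir e.1) = dir e'.1 & phiL (dir e.2) = - dir e'.2].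
Proof.
move=> jb e e'; have [jW ej] := funnelE jb.
have rE : reflected j = (size W - j)%N.
  by rewrite /reflected (interior_word alphaE) prednK // ltnW.
have eb : funnel alphabar (reflected j) = word_edge (take (size W - j) (rev_word W)).
  by rewrite rE (funnel_word alphabarE) // size_rev_word leq_subr.
rewrite /e /e' eb ej; split; try exact: unimodular_word.
  have [] := phi_edge (ltnW W1) alphaE (leq_subr j (size W)).
  by rewrite subKn // ltnW.
have [] := phi_edge (ltnW W1) alphaE (leq_subr j (size W)).
by rewrite subKn // ltnW.
Qed.

Lemma joins_phi j a b : (1 <= j <= interior alpha)%N ->
  let e := swap_sides s (funnel alphabar (reflected j)) in
  joins e.1 (phiL a) (phiL b) = joins (funnel alpha j).1 a b /\
  joins e.2 (phiL a) (phiL b) = joins (funnel alpha j).2 a b.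
Proof.
move=> jb e; have [_ _ h1 h2] := phi_funnel jb.
rewrite /joins -!phi_linearB -h1; split.
  by rewrite !(inj_eq phi_linear_inj).
have -> : dir e.2 = phiL (- dir (funnel alpha j).2) by rewrite /phiL phi_linearN -/phiL h2 opprK.
have nE (x y d : gauss) : (x - y == - d) = (y - x == d) by rewrite -opprB eqr_opp.
by rewrite !(inj_eq phi_linear_inj) !nE orbC.
Qed.

Lemma ordered_tet_phi j S : ordered_tet alpha j S ->
  ordered_tet alphabar (reflected j) (map phiL S).
Proof.
case=> jb [P pS]; split; first exact: reflected_layer.
have [_ _ h1 h2] := phi_funnel jb.
move: h1 h2; rewrite /swap_sides; set e' := funnel alphabar (reflected j) => h1 h2.
have pS' := perm_map phiL pS.
have phiD x y : phiL (x + y) = phiL x + phiL y by apply: phi_linearD.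
rewrite /tet_vertices /= !phiD h1 h2 in pS'.
set p := phiL P in pS'.
exists (p - (if s then dir e'.1 else dir e'.2)); apply: perm_trans pS' _.
rewrite /tet_vertices -/e'; apply/permP => f.
case: (s) => /=; rewrite ?subrK.
  by rewrite [p - _ + _]addrAC; move: (f _) (f _) (f _) (f _) => [] [] [] [].
by rewrite [p - _ + _]addrAC subrK; move: (f _) (f _) (f _) (f _) => [] [] [] [].
Qed.

Lemma joins_exclusive j a b : (1 <= j <= interior alpha)%N ->
  joins (funnel alpha j).1 a b -> joins (funnel alpha j).2 a b = false.
Proof.
move=> jb; have [ue _ _ _] := phi_funnel jb; move: ue; set e := funnel alpha j => ue.
have free x y x' y' : dir e.1 *~ x + dir e.2 *~ y = dir e.1 *~ x' + dir e.2 *~ y' ->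
    x = x' /\ y = y'.
  have := @lattice_point_inj e 0 x y x' y' ue.
  by rewrite /lattice_point !add0r.
have n1 : dir e.1 <> dir e.2.
  by move=> h; have := free 1 0 0 1; rewrite !mulr1z !mulr0z addr0 add0r => /(_ h) [].
have n2 : dir e.1 <> - dir e.2.
  by move=> h; have := free 1 0 0 (-1); rewrite !mulrNz !mulr1z !mulr0z addr0 add0r => /(_ h) [].
have nE (x y d : gauss) : (x - y == d) = (y - x == - d) by rewrite -opprB eqr_oppLR.
rewrite /joins => /orP[]/eqP h; apply/negbTE/negP => /orP[]/eqP h'.
- by apply: n1; rewrite -h -h'.
- by apply: n2; rewrite -h -h' opprB.
- by apply: n2; rewrite -h -h' opprB.
by apply: n1; rewrite -h -h'.
Qed.

(** With left and right ends exchanged, the parameters zeta t and zeta (zeta t) are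
exchanged, and t is kept. *)
Lemma edge_param_phi j t a b : (1 <= j <= interior alpha)%N ->
  edge_param (funnel alphabar (reflected j)) t (phiL a) (phiL b)
  = (if s then
       if joins (funnel alpha j).1 a b then zeta (zeta t)
       else if joins (funnel alpha j).2 a b then zeta t else t
     else edge_param (funnel alpha j) t a b) :> R[i].
Proof.
move=> jb; have [] := joins_phi a b jb; have := @joins_exclusive j a b jb.
rewrite /edge_param /swap_sides; case: s => /= ex -> -> //.
by case: (joins (funnel alpha j).1 a b) ex => // ->.
Qed.

(** Tested at t = i, where the three parameters differ: exchanging two of them
reverses their cyclic order. *)
Lemma not_positive_phi j S : s -> ordered_tet alpha j S ->
  positive_order R alpha j S ->
  ~ positive_order R alphabar (reflected j) (map phiL S).
Proof.
move=> st [jb [P pS]] pos pos'.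
have sz : size S = 4%N by rewrite (perm_size pS).
have t0 : 0 < 'Im ('i : R[i]) by rewrite Im_i ltr01.
have [h _] := pos _ t0; have [h' _] := pos' _ t0.
move: h'; rewrite !(nth_map 0) ?sz //.
rewrite !edge_param_phi // st; move: h; rewrite /edge_param.
have x01 := @joins_exclusive j S`_0 S`_1 jb.
have x12 := @joins_exclusive j S`_1 S`_2 jb.
set a1 := joins _ S`_0 S`_1 in x01 *; set a2 := joins _ S`_0 S`_1 in x01 *.
set b1 := joins _ S`_1 S`_2 in x12 *; set b2 := joins _ S`_1 S`_2 in x12 *.
have i0 : 'i != 0 :> R[i] := neq0Ci _.
have i1 : 1 - 'i != 0 :> R[i] := upper_neq1 t0.
have i3 : zeta (zeta (zeta 'i)) = 'i :> R[i].
  rewrite /zeta; set t : R[i] := 'i in i0 i1 *.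
  have -> : 1 - (1 - t)^-1 = - (t / (1 - t)) by field.
  have -> : 1 - (- (t / (1 - t)))^-1 = t^-1 by field; rewrite i0 i1.
  exact: invrK.
have z12 : zeta 'i != 'i :> R[i].
  rewrite /zeta; apply: contraTneq (ltr01 : 0 < 1 :> R[i]) => e.
  have : 'i * (1 - 'i) = 1 :> R[i] by rewrite -{1}e mulVf.
  rewrite mulrBr mulr1 -expr2 sqrCi opprK => /eqP.
  by rewrite -subr_eq0 addrK (negbTE i0).
have inj : injective (@zeta R[i]).
  by move=> x y /invr_inj /addrI /oppr_inj.
have z23 : zeta (zeta 'i) != zeta 'i :> R[i] by rewrite (inj_eq inj).
have z13 : zeta (zeta 'i) != 'i :> R[i] by rewrite -(inj_eq inj) i3 eq_sym.
clearbody a1 a2 b1 b2.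
case: a1 x01; case: a2; case: b1 x12; case: b2 => x12 x01; try by [have := x01 isT|have := x12 isT].
all: move=> /eqP + /eqP; rewrite ?i3 ?eqxx ?[zeta 'i == _]eq_sym ?['i == _]eq_sym ?(negbTE z12) ?(negbTE z23) ?(negbTE z13) //.
Qed.

Lemma relocate_zip (h : gauss -> gauss) S (t : seq R) :
  relocate h (zip S t) = zip (map h S) t.
Proof. by elim: S t => [|x S IH] [|y t] //=; rewrite -IH. Qed.

Lemma phi_zip j S (t : seq R) :
  phi alpha (j, zip S t) = (reflected j, zip (map phiL S) t).
Proof. by rewrite /phi relocate_zip. Qed.

Lemma reversing_of_ends_right : s -> orientation_reversing alpha alphabar (@phi R alpha).
Proof.
move=> st j S oS pS; exists (reflected j), (map phiL S); split.
- exact: (ordered_tet_phi oS).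
- exact: (not_positive_phi st oS pS).
by move=> t _ _; rewrite phi_zip; apply: Relation_Operators.rst_refl.
Qed.

Let base_tet : seq gauss :=
  let e := funnel alpha 1 in [:: dir e.1; dir e.2; dir e.1 + dir e.2; 0].

Let layer1 : (1 <= 1 <= interior alpha)%N.
Proof. by rewrite (interior_word alphaE); case: (size W) W1 => [|[]]. Qed.

Lemma base_tet_vertices : perm_eq base_tet (tet_vertices alpha 1 0).
Proof. by apply/permP => f; rewrite /tet_vertices /= !add0r; move: (f _) (f _) (f _) (f _) => [] [] [] []. Qed.

Lemma base_tet_ordered : ordered_tet alpha 1 base_tet.
Proof. by split=> //; exists 0; apply: base_tet_vertices. Qed.

Lemma base_tet_positive : positive_order R alpha 1 base_tet.
Proof.
move=> t _; have [ue _ _ _] := phi_funnel layer1.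
pose e := funnel alpha 1; have [d1 d2] := dir_lattice e.
have -> : base_tet = [:: lattice_point e 0 1 0; lattice_point e 0 0 1;
    lattice_point e 0 1 1; lattice_point e 0 0 0].
  by rewrite -d1 -d2 /lattice_point !mulr0z !mulr1z !addr0 add0r.
have J P a b a' b' := joins_lattice P a b a' b' ue.
by rewrite /edge_param /= !(proj1 (J _ _ _ _ _)) !(proj2 (J _ _ _ _ _)).
Qed.

(** If left and right are preserved, a positive order of a tetrahedron of the first
layer has a positive image.  Any other tetrahedron onto which it is carried
agrees with this image up to Theta, including the order of the vertices, which
is read off from a point with four different weights. *)
Lemma ends_right_of_reversing :
  orientation_reversing alpha alphabar (@phi R alpha) -> s.
Proof.
move=> /(_ _ _ base_tet_ordered base_tet_positive) [j' [S' [oS' npos car]]].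
apply: contraT => ns; case: npos.
have ue : unimodular (funnel alpha 1) by have [] := phi_funnel layer1.
pose S := map phiL base_tet.
have oS : ordered_tet alphabar (reflected 1) S := ordered_tet_phi base_tet_ordered.
have uB : uniq base_tet by rewrite (perm_uniq base_tet_vertices) uniq_tet_vertices.
have uS : uniq S by rewrite map_inj_uniq //; apply: phi_linear_inj.
have sB : size base_tet = 4%N by [].
have [jb' [P' pS']] := oS'; have [jb [P pS]] := oS.
have sS' : size S' = 4%N by rewrite (perm_size pS').
have W1' : (1 < size (rev_word W))%N by rewrite size_rev_word.
have uS' : uniq S'.
  rewrite (perm_uniq pS') uniq_tet_vertices // (funnel_word alphabarE); first exact: unimodular_word.
  by move: jb'; rewrite (interior_word alphabarE) => /andP[_ /leq_trans]; apply; apply: leq_pred.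
(* Distinct positive weights of sum 1 tell the four vertices apart. *)
pose t : seq R := [:: 1 / 10; 2 / 10; 3 / 10; 4 / 10].
have tval k : (k < 4)%N -> nth 0 t k = k.+1%:R / 10 by case: k => [|[|[|[|]]]].
have wS k : (k < 4)%N -> weight (zip S t) (nth 0 S k) = k.+1%:R / 10.
  by move=> k4; rewrite weight_zip // tval.
have wS' k : (k < 4)%N -> weight (zip S' t) (nth 0 S' k) = k.+1%:R / 10.
  by move=> k4; rewrite weight_zip ?sS' // tval.
have ten k : k.+1%:R / 10 != 0 :> R by rewrite mulf_neq0 ?invr_eq0 ?pnatr_eq0.
have MS : M_points alpha (1%N, zip base_tet t).
  split.
  - exact: layer1.
  - exists 0 => -[x y] h; split.
      rewrite -(perm_mem base_tet_vertices).
      by have := map_f fst h; rewrite -/unzip1 unzip1_zip.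
    have := map_f snd h; rewrite -/unzip2 unzip2_zip //= /t !inE.
    by do ![case/orP] => /eqP ->; rewrite divr_ge0.
  - by rewrite /= !big_cons big_nil /=; field.
  move=> x; have [xB|xB] := boolP (x \in base_tet).
    have [k kB <-] := nthP 0 xB; rewrite weight_zip // tval // ltr_pdivrMr // mul1r ltr_nat.
    by apply: leq_ltn_trans kB _.
  suff -> : weight (zip base_tet t) x = 0 by [].
  apply/eqP; apply: contraNT xB => /weight_mem.
  by rewrite -/unzip1 unzip1_zip.
have := car t erefl MS; rewrite phi_zip -/S => Meq.
have l0pos x : x \in tet_vertices alphabar (reflected 1) P -> weight (zip S t) x != 0.
  by rewrite -(perm_mem pS) => /(nthP 0)[k kS <-]; rewrite wS.
have [|ej [n [c h]]] := M_eq_copy W1' alphabarE jb l0pos Meq.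
  by split=> //; exists false, 0 => x; rewrite /flip_shift addr0.
have {}ej : j' = reflected 1 := ej.
have nthS k : (k < 4)%N -> nth 0 S' k = flip_shift n c (nth 0 S k).
  move=> k4; have : weight (zip S' t) (flip_shift n c (nth 0 S k)) = k.+1%:R / 10.
    by rewrite h wS.
  move=> e; have : flip_shift n c (nth 0 S k) \in S'.
    have := ten k; rewrite -e => /weight_mem.
    by rewrite -/unzip1 unzip1_zip ?sS'.
  case/(nthP 0) => i i4 ei; rewrite sS' in i4; move: e; rewrite -ei wS' //.
  move/(mulIf (_ : 10^-1 != 0 :> R)); rewrite invr_eq0 pnatr_eq0 => /(_ isT) /eqP.
  by rewrite eqr_nat eqSS => /eqP ->.
move=> tt tt0; have := base_tet_positive tt0.
have E k m : (k < 4)%N -> (m < 4)%N ->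
    edge_param (funnel alphabar j') tt (nth 0 S' k) (nth 0 S' m)
      = edge_param (funnel alpha 1) tt (nth 0 base_tet k) (nth 0 base_tet m).
  move=> k4 m4; rewrite !nthS // /edge_param !joins_flip_shift ej.
  have := edge_param_phi tt (nth 0 base_tet k) (nth 0 base_tet m) layer1.
  by rewrite (negbTE ns) /edge_param /S !(nth_map 0).
by rewrite /= !E.
Qed.

Lemma orientation_reversingP :
  orientation_reversing alpha alphabar (@phi R alpha) <-> ends_right W.
Proof. by split; [apply: ends_right_of_reversing|apply: reversing_of_ends_right]. Qed.

End Orientation.

(** * The theorem *)

Theorem theorem7p6 (R : realType) (Q : slope -> {poly int})
    (alpha alphabar : rat) (z1 : R[i]) :
  is_calQ Q ->
  0 < alpha -> alpha < 1 / 2 -> alpha^-1 \isn't a Num.int ->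
  is_reverse alpha alphabar ->
  geometric_root Q alpha z1 ->
  let zn := calZ Q (funnel alpha (interior alpha)) z1 in
  (orientation_reversing alpha alphabar (@phi R alpha) ->
     geometric_root Q alphabar (zn^*)^-1)
  /\ (orientation_reversing alpha alphabar (@phi R alpha) <-> 1 <= `|zn|).
Proof.
move=> calQ _ _ nint rev [root uniq_root] zn.
have [W [alphaE alphabarE hW fW]] := reverse_words rev nint.
have W1 : (1 < size W)%N by case: (W) hW fW => [|[] []].
have W0 := ltnW W1.
have V0 : (0 < size (rev_word W))%N by rewrite size_rev_word.
have hV := head_rev_word W0.
(* Between two left turns and with a right turn there are at least three letters,
   so the bound on the root is strict. *)
have fV : ends_right W \/ (2 < size W)%N.
  rewrite /ends_right; case: (W) hW fW => [|[] [|[] [|c V]]] //= _; by [right|left].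
have geoP z := geometricE Q z W0 alphaE; have geoVP z := geometricE Q z V0 alphabarE.
have geo : geometric Q W z1 by apply/geoP.
have znE : zn = calZ Q (word_edge (take (size W).-1 W)) z1.
  by rewrite /zn (interior_word alphaE) (funnel_word alphaE) // leq_pred.
have [geoV endV] := geometric_rev calQ hW W1 geo.
rewrite -znE in geoV endV.
have zn0 : zn != 0.
  move: geoV => [/upper_neq0 + _ _]; case: ifP => _ //.
  by rewrite invr_eq0 conjC_eq0.
have memV : false \in rev_word W.
  rewrite mem_rev; case: (ends_right W); last by rewrite (map_f (addb false) fW).
  by rewrite (map_f (addb true) (x := true)) //; case: (W) hW => [|[]].
have bound := geometric_norm calQ hV geoV memV.
rewrite size_rev_word in bound.
have orP := orientation_reversingP R W1 alphaE alphabarE.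
split.
- move/orP => s; rewrite s in geoV endV; split; first by apply/geoVP.
  (* The reversal of any root w for alphabar is the root z1 for alpha, and the
     reversal of z1 is w again. *)
  move=> w /geoVP geow.
  have [] := geometric_rev calQ hV _ geow; first by rewrite size_rev_word.
  rewrite ends_right_rev // rev_wordK // size_rev_word s => /geoP /uniq_root ez endw.
  by rewrite -ez -znE in endw; rewrite -fmorphV endw invrK; exact: conjCK.
- split=> [/orP s|zn1].
    move: bound; rewrite s => /lteifW.
    by rewrite normfV norm_conjC invf_le1 // normr_gt0.
apply/orP; apply: contraLR zn1 => /negbTE ns; rewrite ns in bound fV.
case: fV => // W2; rewrite leqNgt W2 /= in bound.
by rewrite lt_geF.
Qed.
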